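(* Let $\mathbf{d}$ be a Dyck path on an $n\times n$ board with bounce number $|\mathbf{m}|=3$, let $P=P(\mathbf{d})$, and let $G=\mathrm{inc}(P)$. Let $c=|S_1|$, $b=|S_2|$, $a=|S_3|$. Then for every integer $l$ with $0\le l\le\min\{a,b,c\}$, the coefficient of $e_{(n-2l-1,l+1,l)}$ in the expansion of $X_G(\mathbf{x},q)$ in the elementary symmetric function basis lies in $\mathbb{N}[q]$.
   Context: A Dyck path on an $n\times n$ board is a sequence $\mathbf{d}=(d_1,\dots,d_{n-1})$ of positive integers with $d_1\le\cdots\le d_{n-1}\le n$ and $d_i\ge i$. The poset $P(\mathbf{d})$ on $[n]$ has relations $i\prec j$ iff $i<n$ and $d_i<j\le n$ (a natural unit interval order). The bounce sequence $\mathbf{m}=(m_0,\dots,m_l)$ is given by $m_0=d_1$, $m_i=d_{m_{i-1}+1}$, stopping at $m_l=n$; the bounce number is $|\mathbf{m}|=l+1$. When $|\mathbf{m}|=3$, $\mathbf{m}=(m_0,m_1,n)$ and $S_1=\{1,\dots,m_0\}$, $S_2=\{m_0+1,\dots,m_1\}$, $S_3=\{m_1+1,\dots,n\}$. The incomparability graph $\mathrm{inc}(P)$ has vertex set $[n]$ with an edge between two elements iff they are incomparable in $P$. For a graph $G$ on vertex set $[n]$, the chromatic quasisymmetric function is $X_G(\mathbf{x},q)=\sum_{\kappa}q^{\mathrm{asc}(\kappa)}\prod_{v}x_{\kappa(v)}$, summed over proper colorings $\kappa:[n]\to\{1,2,3,\dots\}$, where $\mathrm{asc}(\kappa)$ is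 the number of edges $\{i,j\}$ with $i<j$ and $\kappa(i)<\kappa(j)$; for $G=\mathrm{inc}(P(\mathbf{d}))$ it is symmetric in $\mathbf{x}$, and $e_\lambda$ denotes the elementary symmetric functions. *)

(* Defs.v *)
From mathcomp Require Import all_boot all_order all_algebra.
From mathcomp Require Import mpoly.

Set Implicit Arguments.
Unset Strict Implicit.
Unset Printing Implicit Defensive.

Import Order.TTheory GRing.Theory Num.Theory.

Local Open Scope ring_scope.

(* A path d = (d_1, ..., d_(n-1)) is a sequence of n-1 naturals.  The default
   value of [nth] extends it by d_i = n for i >= n; the value d_n = n is needed
   by the bounce recursion when m_(i-1) = n-1. *)
Definition dyck_at (n : nat) (d : seq nat) (i : nat) : nat := nth n d i.-1.

Definition dyck_path (n : nat) (d : seq nat) : Prop :=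
  [/\ (0 < n)%N,
      size d = n.-1,
      sorted leq d,
      forall i : nat, (1 <= i < n)%N -> (0 < dyck_at n d i <= n)%N
    & forall i : nat, (1 <= i < n)%N -> (i <= dyck_at n d i)%N].

(* The ordinal v : 'I_n stands for the element v.+1 of [n] = {1, ..., n}. *)
Definition dyck_prec (n : nat) (d : seq nat) : rel 'I_n :=
  fun i j => (i.+1 < n)%N && (dyck_at n d i.+1 < j.+1 <= n)%N.

Definition incomparability (n : nat) (prec : rel 'I_n) : rel 'I_n :=
  fun i j => [&& i != j, ~~ prec i j & ~~ prec j i].

(* As d_i >= i, the sequence f 0, f (f 0), ... with f m = d_(m+1) increases
   strictly until it reaches n, which takes at most n terms. *)
Definition bounce_seq (n : nat) (d : seq nat) : seq nat :=
  let f m := dyck_at n d m.+1 in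
  let m := traject f (f 0%N) n in
  take (index n m).+1 m.

Definition bounce_number (n : nat) (d : seq nat) : nat := size (bounce_seq n d).

(* S_k = {m_(k-2) + 1, ..., m_(k-1)} for 1 <= k, where m_(-1) = 0. *)
Definition bounce_block (n : nat) (d : seq nat) (k : nat) : {set 'I_n} :=
  let m := 0%N :: bounce_seq n d in
  [set v : 'I_n | (nth 0%N m k.-1 < v.+1 <= nth 0%N m k)%N].

Definition proper_coloring (n N : nat) (G : rel 'I_n)
    (kappa : {ffun 'I_n -> 'I_N}) : bool :=
  [forall i, forall j, G i j ==> (kappa i != kappa j)].

Definition asc (n N : nat) (G : rel 'I_n) (kappa : {ffun 'I_n -> 'I_N}) : nat :=
  #|[set e : 'I_n * 'I_n |
      [&& G e.1 e.2, (e.1 < e.2)%N & (kappa e.1 < kappa e.2)%N]]|.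

(* A formal power series of bounded degree in x_1, x_2, ... is given by its
   truncations x_(N+1) = x_(N+2) = ... = 0, one polynomial in N variables for
   every N; {poly int} is Z[q]. *)
Definition truncations : Type := forall N : nat, {mpoly {poly int}[N]}.

(* Setting x_i = 0 for i > N keeps exactly the colorings with values among the
   first N colors. *)
Definition chromatic_qsym (n : nat) (G : rel 'I_n) : truncations :=
  fun N => \sum_(kappa : {ffun 'I_n -> 'I_N} | proper_coloring G kappa)
    ('X^(asc G kappa) : {poly int}) *: \prod_(v : 'I_n) 'X_(kappa v).

(* [mesym N R k] is 1 for k = 0 and 0 for k > N. *)
Definition elem_sym (lam : seq nat) : truncations :=
  fun N => \prod_(k <- lam) mesym N {poly int} k.

Definition is_partition (n : nat) (lam : seq nat) : bool :=
  [&& sorted geq lam, 0%N \notin lam & sumn lam == n].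

(* F = sum over the partitions lam of n of c_lam e_lam.  A partition of n has
   at most n parts, all at most n, hence the finite index type; only the values
   of c at partitions of n matter. *)
Definition e_expansion (n : nat) (F : truncations)
    (c : seq nat -> {poly int}) : Prop :=
  forall N : nat,
    F N = \sum_(lam : n.-bseq 'I_n.+1 | is_partition n (map val lam))
            c (map val lam) *: elem_sym (map val lam) N.

(* e_(n-2l-1, l+1, l) is indexed up to reordering and zero parts. *)
Definition to_partition (s : seq nat) : seq nat :=
  sort geq [seq k <- s | (0 < k)%N].

(* Exponent of e_lam as a monomial in e_1, ..., e_n. *)
Definition e_exponent (n : nat) (lam : seq nat) : 'X_{1..n} := [multinom count_mem i.+1 lam | i < n].

Lemma partition_bounds n lam k :
  is_partition n lam -> k \in lam -> (0 < k <= n)%N.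
Proof.
case/and3P=> _ lam0 /eqP <- k_lam; apply/andP; split.
  by rewrite lt0n; apply: contraNneq lam0 => <-.
by move: k_lam => /splitPr[s1 s2]; rewrite sumn_cat /= addnCA leq_addr.
Qed.

Lemma elem_sym_comp n (lam : seq nat) :
  {in lam, forall k, (0 < k <= n)%N} ->
  elem_sym lam n = 'X_[e_exponent n lam] \mPo [tuple mesym n {poly int} i.+1 | i < n].
Proof.
rewrite comp_mpolyX /elem_sym; elim: lam => [|k lam IH] lam_n.
  by rewrite big_nil big1 // => i _; rewrite mnmE expr0.
rewrite big_cons IH => [|j j_lam]; last by rewrite lam_n // inE j_lam orbT.
have /andP[k_gt0 k_n] : (0 < k <= n)%N by rewrite lam_n // mem_head.
have k_lt : (k.-1 < n)%N by rewrite prednK.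
rewrite (bigD1 (Ordinal k_lt)) // [RHS](bigD1 (Ordinal k_lt)) //= mulrA.
rewrite !tnth_mktuple !mnmE /= prednK // eqxx add1n exprS; congr (_ * _).
apply: eq_bigr => i /eqP i_k; rewrite !mnmE /=.
case: eqP => // k_i; case: i_k; apply: val_inj.
by rewrite /= k_i.
Qed.

Lemma e_exponent_inj n lam mu :
  is_partition n lam -> is_partition n mu -> e_exponent n lam = e_exponent n mu -> lam = mu.
Proof.
move=> lamP muP /mnmP eq_mult.
have geq_tr : transitive geq by move=> ? ? ? /[swap]; apply: leq_trans.
have geq_anti : antisymmetric geq.
  by move=> x y; rewrite andbC; exact: anti_leq.
apply: (sorted_eq geq_tr geq_anti); first by case/and3P: lamP.
  by case/and3P: muP.
apply/allP=> k k_in; apply/eqP.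
have /andP[k_gt0 k_n] : (0 < k <= n)%N.
  by move: k_in; rewrite mem_cat => /orP[]; apply: partition_bounds.
have k_lt : (k.-1 < n)%N by rewrite prednK.
by have := eq_mult (Ordinal k_lt); rewrite !mnmE /= prednK.
Qed.

Lemma partition_bseq n lam : is_partition n lam ->
  exists s : n.-bseq 'I_n.+1, map val s = lam.
Proof.
move=> lamP; have bnd := partition_bounds lamP.
have sz : (size [seq inord k : 'I_n.+1 | k <- lam] <= n)%N.
  rewrite size_map; case/and3P: lamP => _ _ /eqP sum_lam.
  rewrite -[leqRHS]sum_lam; elim: (lam) bnd => //= k s IH bnd.
  rewrite -add1n leq_add //.
    by have /andP[] := bnd k (mem_head _ _).
  by apply: IH => j j_s; rewrite bnd // inE j_s orbT.
exists (Bseq sz); rewrite /= -map_comp -[RHS]map_id; apply/eq_in_map.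
by move=> k /bnd /andP[_ k_n] /=; rewrite inordK.
Qed.

(* The e_lam are linearly independent: an expansion has unique coefficients. *)
Lemma e_expansion_unique (n : nat) (F : truncations) (c c' : seq nat -> {poly int}) :
  e_expansion n F c -> e_expansion n F c' ->
  forall lam, is_partition n lam -> c lam = c' lam.
Proof.
move=> Fc Fc' lam lamP; have [s s_lam] := partition_bseq lamP.
pose t (b : seq nat -> {poly int}) : {mpoly {poly int}[n]} :=
  \sum_(r : n.-bseq 'I_n.+1 | is_partition n (map val r))
    b (map val r) *: 'X_[e_exponent n (map val r)].
have tE b : e_expansion n F b ->
    F n = t b \mPo [tuple mesym n {poly int} i.+1 | i < n].
  move=> Fb; rewrite Fb raddf_sum; apply: eq_bigr => r rP /=.
  by rewrite comp_mpolyZ elem_sym_comp // => k; apply: partition_bounds.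
have coefE b : (t b)@_(e_exponent n lam) = b lam.
  rewrite raddf_sum (bigD1 s) /= s_lam // mcoeffZ mcoeffX eqxx mulr1.
  rewrite big1 ?addr0 // => r /andP[rP r_s].
  rewrite mcoeffZ mcoeffX; case: eqP => [/(e_exponent_inj rP lamP) r_lam|]; last first.
    by rewrite mulr0.
  case/eqP: r_s; apply: val_inj; apply: (inj_map val_inj).
  by rewrite /= r_lam s_lam.
have /msym_fundamental_un eq_t := etrans (esym (tE c Fc)) (tE c' Fc').
by rewrite -coefE eq_t coefE.
Qed.

(* Main.v *)
(* Let L be the linear functional on symmetric polynomials in t_1, t_2, t_3 that
   sends e_(a_1) ... e_(a_r) to the generating function, by ascents, of the
   proper colorings whose color classes have sizes a_1, ..., a_r.  It is well
   defined because these counts do not depend on the order of the a_i, and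
   because the color classes are chains of P, which have at most 3 elements.
   Since prod_i sum_a e_a(t) x_i^a = prod_(i,j) (1 + x_i t_j) =
   sum_lam m_lam(t) e_lam(x), the coefficient of e_lam in X_G is L(m_lam(t)).
   For lam = (k + l, l + 1, l) with k >= 2 we have m_lam = e_3^l (p_1 p_k - p_(k+1)).
   On a poset with k elements, L(p_k) is a weighted count of words by Newton's
   identities; deleting the first letter embeds the words counted by L(p_(k+1))
   in those counted by L(p_1 p_k), whence positivity. *)
Require Import Defs.
From mathcomp Require Import all_boot all_order all_algebra.
From mathcomp Require Import perm mpoly ring zify.

Set Implicit Arguments.
Unset Strict Implicit.
Unset Printing Implicit Defensive.

Import Order.TTheory GRing.Theory Num.Theory.
Local Open Scope ring_scope.

(** Independence of the order is local: exchanging two consecutive color classes only concerns the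
    set that they cover. It makes multiplication by e_a the same as removing a chain of a elements
    first. As for the words, absence of descents alone models the complete homogeneous h_k, with h_k
    = e_1 h_(k-1) - e_2 h_(k-2) + e_3 h_(k-3) and h_0 = 1. Newton's identities have the same shape,
    but for k <= 3 they end in k e_k instead of e_k; forbidding a letter below all later ones
    supplies the missing copies. The price is a correction for every element below all the others,
    and on more than three elements these corrections must cancel. Here the bound on chains enters a
    second time: such an element takes up a level of its own, so that the remaining elements contain
    no chain of three. *)

(** * Disjoint unions and polynomials with natural coefficients *)

Lemma sum_setU_disjoint (V : nmodType) (T : finType) (A B : {set T}) (F : T -> V) :
  [disjoint A & B] ->
  \sum_(x in A :|: B) F x = \sum_(x in A) F x + \sum_(x in B) F x.
Proof.
move=> dis; rewrite -bigU //=.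
by apply: eq_bigl => x; rewrite !inE.
Qed.

Lemma nat_polyD (p q : {poly int}) :
  p \is a polyOver Num.nat -> q \is a polyOver Num.nat -> p + q \is a polyOver Num.nat.
Proof.
by move=> /polyOverP hp /polyOverP hq; apply/polyOverP => i; rewrite coefD rpredD.
Qed.

Lemma nat_polyM (p q : {poly int}) :
  p \is a polyOver Num.nat -> q \is a polyOver Num.nat -> p * q \is a polyOver Num.nat.
Proof.
move=> /polyOverP hp /polyOverP hq; apply/polyOverP => i.
by rewrite coefM rpred_sum // => j _; rewrite rpredM.
Qed.

Lemma nat_poly_sum (I : Type) (r : seq I) (P : pred I) (F : I -> {poly int}) :
  (forall i, P i -> F i \is a polyOver Num.nat) ->
  \sum_(i <- r | P i) F i \is a polyOver Num.nat.
Proof.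
by move=> F_nat; elim/big_ind: _ => //; [exact: polyOver0 | exact: nat_polyD].
Qed.

Lemma nat_polyXn k : ('X^k : {poly int}) \is a polyOver Num.nat.
Proof. exact: polyOverXn. Qed.

Lemma nat_poly_bool (b : bool) : (b%:R : {poly int}) \is a polyOver Num.nat.
Proof. by case: b; [exact: (nat_polyXn 0) | exact: polyOver0]. Qed.

(** * Weighted ordered partitions into chains *)

Section ChainCounts.

Variables (n : nat) (prec : rel 'I_n).
Implicit Types (x y z v : 'I_n) (A B U W : {set 'I_n}) (a b : nat) (s : seq nat).

(** Once [prec] implies [<], the relation [prec y x] is excluded for [x < y], so this is adjacency
    in the incomparability graph, oriented upwards. *)
Definition inc_ascent x y := (x < y)%N && ~~ prec x y.

Definition ascents A B : nat := \sum_(x in A) \sum_(y in B) inc_ascent x y.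

Definition chain A := [forall x in A, forall y in A, (x < y)%N ==> prec x y].

Definition asc_weight A B : {poly int} := 'X^(ascents A B).

(** Blocks are the color classes in increasing order of color. Each is weighed against everything
    still left, so an ascent of the coloring is counted once, at its smaller color. *)
Fixpoint chain_count W s : {poly int} :=
  if s is a :: s' then
    \sum_(A : {set 'I_n} | [&& A \subset W, chain A & #|A| == a])
      asc_weight A (W :\: A) * chain_count (W :\: A) s'
  else (W == set0)%:R.

Lemma chainP A :
  reflect (forall x y, x \in A -> y \in A -> (x < y)%N -> prec x y) (chain A).
Proof.
apply: (iffP idP) => [/forall_inP h x y xA yA|h].
  by move: (h x xA) => /forall_inP/(_ y yA)/implyP; apply.
by apply/forall_inP => x xA; apply/forall_inP => y yA; apply/implyP; apply: h.
Qed.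

Lemma chain_sub A B : A \subset B -> chain B -> chain A.
Proof.
move=> /subsetP AB /chainP h; apply/chainP => x y xA yA.
by apply: h; apply: AB.
Qed.

Lemma ascentsUl A A' B :
  [disjoint A & A'] -> ascents (A :|: A') B = (ascents A B + ascents A' B)%N.
Proof. by move=> dis; rewrite /ascents sum_setU_disjoint. Qed.

Lemma ascentsUr A B B' :
  [disjoint B & B'] -> ascents A (B :|: B') = (ascents A B + ascents A B')%N.
Proof.
by move=> dis; rewrite /ascents -big_split; apply: eq_bigr => x _; rewrite sum_setU_disjoint.
Qed.

Lemma ascents0l B : ascents set0 B = 0%N.
Proof. by rewrite /ascents big_set0. Qed.

Lemma ascents_eq0 A B :
  (forall x y, x \in A -> y \in B -> ~~ inc_ascent x y) -> ascents A B = 0%N.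
Proof.
move=> h; rewrite /ascents big1 // => x xA; rewrite big1 // => y yB.
by rewrite (negbTE (h _ _ xA yB)).
Qed.

Lemma chain_count0 W s : chain_count W (0 :: s) = chain_count W s.
Proof.
rewrite /= (big_pred1 set0).
  by rewrite /asc_weight ascents0l setD0 expr0 mul1r.
move=> A; rewrite /= cards_eq0.
case: (A =P set0) => [->|_]; rewrite ?andbF //= sub0set andbT /=.
by apply/chainP => x y; rewrite inE.
Qed.

Lemma chain_count_size W s : sumn s != #|W| -> chain_count W s = 0.
Proof.
elim: s W => [|a s IH] W /=; first by rewrite eq_sym cards_eq0 => /negbTE->.
move=> ne; rewrite big1 // => A /and3P[AW _ /eqP cA]; rewrite IH ?mulr0 //.
by apply: contraNneq ne => ->; rewrite cardsDS // -cA subnKC // subset_leq_card.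
Qed.

Definition two_chains U a b : {poly int} :=
  \sum_(A : {set 'I_n} | [&& A \subset U, chain A, chain (U :\: A), #|A| == a & #|U :\: A| == b])
    asc_weight A (U :\: A).

(** Grouping by the union [U] of the first two blocks: the ascents from [U] to the rest do not
    depend on how [U] is divided, so exchanging the two sizes becomes a question about [two_chains]
    only. *)
Lemma chain_count2 W a b s :
  chain_count W [:: a, b & s] =
  \sum_(U : {set 'I_n} | U \subset W) two_chains U a b * (asc_weight U (W :\: U) * chain_count (W :\: U) s).
Proof.
under [RHS]eq_bigr do rewrite big_distrl /=.
rewrite (exchange_big_dep (fun A => [&& A \subset W, chain A & #|A| == a])) /=; last first.
  by move=> U A UW /and5P[AU -> _ -> _]; rewrite (subset_trans AU UW).
apply: eq_bigr => A /and3P[AW cA sA]; rewrite big_distrr /=.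
rewrite [RHS](reindex_onto (fun B => A :|: B) (fun U => U :\: A)) /=; last first.
  by move=> U /andP[_ /and5P[/setIidPr AU _ _ _ _]]; rewrite -{1}AU setID.
apply: eq_big => [B|B /and3P[BW cB sB]].
  rewrite cA sA subsetUl subUset AW /= setDUl setDv set0U.
  rewrite subsetD andbC -!andbA; case: (boolP [disjoint B & A]) => [dis|ndis] /=.
    have -> : B :\: A = B by apply/setDidPl.
    by rewrite eqxx !andbT [RHS]andbC -andbA.
  have -> : (B :\: A == B) = false by apply/eqP => /setDidPl; rewrite (negbTE ndis).
  by rewrite !andbF.
have dis : [disjoint B & A] by move: BW; rewrite subsetD => /andP[].
have BA : (A :|: B) :\: A = B by rewrite setDUl setDv set0U; apply/setDidPl.
rewrite BA /asc_weight setDDl mulrA mulrA -!exprD; congr ('X^_ * _).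
have -> : W :\: A = B :|: W :\: (A :|: B).
  by rewrite -setDDl setUC -{1}(setID (W :\: A) B) setUC; congr setU; apply/setIidPr.
have dis2 : [disjoint B & W :\: (A :|: B)].
  by rewrite disjoint_sym disjoints_subset; apply/subsetP => v; rewrite !inE negb_or => /andP[/andP[]].
rewrite ascentsUr // ascentsUl 1?disjoint_sym // setUC.
suff -> : W :\: (B :|: A) = (B :|: W :\: (B :|: A)) :\: B by rewrite addnA.
by rewrite setDUl setDv set0U; symmetry; apply/setDidPl; rewrite disjoint_sym setUC.
Qed.

Hypothesis prec_lt : forall x y, prec x y -> (x < y)%N.
Hypothesis prec_mono : forall x x' y y',
  (x <= x')%N -> prec x' y' -> (y' <= y)%N -> prec x y.

(** * Symmetry between two complementary chains *)

Section TwoChains.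

Variables (K : comNzRingType) (q : K).

(** All sizes are treated at once, marked by [u] and [w]; the ring is arbitrary so that [u], [w] and
    [q] can become independent indeterminates. *)
Definition bichain_sum (P : pred {set 'I_n}) (u w : K) U : K :=
  \sum_(A : {set 'I_n} | [&& P A, A \subset U, chain A & chain (U :\: A)])
    u ^+ #|A| * w ^+ #|U :\: A| * q ^+ ascents A (U :\: A).

Definition above x A := [forall y in A, prec x y].

Lemma chain_add v A : (forall x, x \in A -> (v < x)%N) ->
  chain (v |: A) = chain A && above v A.
Proof.
move=> lt_v; apply/idP/andP => [vA|[/chainP cA /forall_inP vA]].
  split; first exact: chain_sub (subsetUr _ _) vA.
  apply/forall_inP => y yA; move/chainP: vA => /(_ v y); rewrite !inE eqxx yA orbT.
  by apply => //; apply: lt_v.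
apply/chainP => x y /setU1P[->|xA] /setU1P[->|yA]; first by rewrite ltnn.
- by move=> _; apply: vA.
- by move=> lt_xv; have := ltn_trans lt_xv (lt_v _ xA); rewrite ltnn.
- exact: cA.
Qed.

Lemma bichain_sum_in v U u w : (forall x, x \in U -> (v < x)%N) ->
  bichain_sum (fun A => v \in A) u w (v |: U) =
  \sum_(A : {set 'I_n} | [&& A \subset U, chain A, chain (U :\: A) & above v A])
    u * q ^+ ascents [set v] (U :\: A) *
    (u ^+ #|A| * w ^+ #|U :\: A| * q ^+ ascents A (U :\: A)).
Proof.
move=> lt_v; have vU : v \notin U by apply/negP => /lt_v; rewrite ltnn.
rewrite /bichain_sum.
rewrite (reindex_onto (fun A => v |: A) (fun A => A :\ v)) /=; last first.
  by move=> A /andP[vA _]; rewrite setD1K.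
have DA A : A \subset U -> (v |: U) :\: (v |: A) = U :\: A.
  move=> AU; rewrite setDUl setDUr setDv set0I set0U setDUr.
  by apply/setIidPr; rewrite subsetD1 !inE (negbTE vU) andbF andbT subsetDl.
have vnA A : A \subset U -> v \notin A by move=> /subsetP AU; apply: contra vU; apply: AU.
have lt_vA A : A \subset U -> forall x, x \in A -> (v < x)%N.
  by move=> /subsetP AU x /AU/lt_v.
have subA A : v |: A \subset v |: U -> (v |: A) :\ v = A -> A \subset U.
  move=> /subsetP AU eqA; have vA : v \notin A by rewrite -eqA !inE eqxx.
  apply/subsetP => x xA; move: (AU x); rewrite !inE xA orbT => /(_ isT).
  by case/orP => // /eqP xv; rewrite -xv xA in vA.
apply: eq_big => [A|A /andP[/and4P[_ vUA _ _] /eqP eqA]].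
  rewrite setU11 /=; apply/idP/idP.
    case/andP=> /and3P[AU cA cD] /eqP eqA; have {}AU := subA _ AU eqA.
    rewrite AU; move: cD; rewrite DA // => ->; move: cA.
    by rewrite chain_add; [case/andP=> -> -> | apply: lt_vA].
  case/and4P=> AU cA cD aA; rewrite DA // cD setUS // chain_add ?cA ?aA.
    by rewrite setU1K ?eqxx // vnA.
  exact: lt_vA.
have AU := subA _ vUA eqA.
rewrite DA // cardsU1 (vnA _ AU) exprS /ascents big_setU1 ?vnA //= exprD.
by rewrite big_set1; ring.
Qed.

Lemma bichain_sum_out v U u w : (forall x, x \in U -> (v < x)%N) ->
  bichain_sum (fun A => v \notin A) u w (v |: U) =
  \sum_(A : {set 'I_n} | [&& A \subset U, chain A, chain (U :\: A) & above v (U :\: A)])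
    w * (u ^+ #|A| * w ^+ #|U :\: A| * q ^+ ascents A (U :\: A)).
Proof.
move=> lt_v; have vU : v \notin U by apply/negP => /lt_v; rewrite ltnn.
have DA A : A \subset U -> (v |: U) :\: A = v |: (U :\: A).
  move=> /subsetP AU; rewrite setDUl; congr (_ :|: _); apply/setDidPl.
  by rewrite disjoints1; apply: contra vU; apply: AU.
rewrite /bichain_sum; apply: eq_big => [A|A /and4P[vA AU _ _]].
  have -> : [&& v \notin A, A \subset v |: U, chain A & chain ((v |: U) :\: A)] =
     [&& A \subset U, chain A & chain ((v |: U) :\: A)].
    rewrite andbA; congr (_ && _); apply/andP/idP => [[vA /subsetP AU]|AU].
      apply/subsetP => x xA; move: (AU x xA); rewrite !inE.
      by case: eqP => // xv; rewrite -xv xA in vA.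
    split; last exact: subset_trans AU (subsetUr _ _).
    by apply: contra vU; apply: (subsetP AU).
  case AU : (A \subset U) => //=; rewrite DA // chain_add ?andbA //.
  by move=> x; rewrite inE => /andP[_ /lt_v].
have {}AU : A \subset U.
  apply/subsetP => x xA; move/subsetP/(_ x xA) : AU; rewrite !inE.
  by case: eqP => // xv; rewrite -xv xA in vA.
rewrite DA // cardsU1 !inE (negbTE vU) andbF exprS.
have -> : ascents A (v |: U :\: A) = ascents A (U :\: A).
  rewrite /ascents; apply: eq_bigr => x xA; rewrite big_setU1 ?inE ?(negbTE vU) ?andbF //=.
  by rewrite /inc_ascent ltnNge ltnW // lt_v // (subsetP AU).
by ring.
Qed.

Lemma bichain_sum_split v U u w : bichain_sum xpredT u w U =
  bichain_sum (fun A => v \in A) u w U + bichain_sum (fun A => v \notin A) u w U.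
Proof.
rewrite /bichain_sum (bigID (fun A : {set 'I_n} => v \in A)) /=.
by congr (_ + _); apply: eq_bigl => A; rewrite andbC.
Qed.

Lemma exists_min U z : z \in U ->
  exists2 v, v \in U & forall x, x \in U :\ v -> (v < x)%N.
Proof.
move=> zU; case: (@arg_minnP _ z (mem U) val zU) => v vU min_v; exists v => // x.
rewrite !inE => /andP[xv /min_v vx]; rewrite ltn_neqAle vx andbT.
by apply: contra xv => /eqP/val_inj->.
Qed.

(* The incomparability graph of a union of two chains is a disjoint union of
   paths along increasing elements; the two cases are those of a first path
   with an odd and with an even number of vertices. *)
Lemma bichain_sumC_pairs v U : (forall x, x \in U -> (v < x)%N) ->
  forall u w, exists s : K,
   [/\ bichain_sum (fun A => v \in A) u w (v |: U) = u * s,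
       bichain_sum (fun A => v \notin A) u w (v |: U) = w * s,
       bichain_sum (fun A => v \in A) w u (v |: U) = w * s &
       bichain_sum (fun A => v \notin A) w u (v |: U) = u * s] \/
   [/\ bichain_sum (fun A => v \in A) u w (v |: U) = q * s,
       bichain_sum (fun A => v \notin A) u w (v |: U) = s,
       bichain_sum (fun A => v \in A) w u (v |: U) = q * s &
       bichain_sum (fun A => v \notin A) w u (v |: U) = s].
Proof.
have [k] := ubnP #|U|; elim: k v U => // k IH v U ltUk lt_v u w.
have [U0|[z zU]] := set_0Vmem U.
  exists 1; left; rewrite !bichain_sum_in // !bichain_sum_out // U0.
  have E (F : {set 'I_n} -> K) (P : pred {set 'I_n}) : P set0 ->
      \sum_(A : {set 'I_n} | (A \subset set0) && P A) F A = F set0.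
    move=> P0; rewrite (big_pred1 set0) // => A /=; rewrite subset0.
    by case: eqP => // ->.
  have ch0 : chain set0 by apply/chainP => x y; rewrite inE.
  have ab0 : above v set0 by apply/forall_inP => x; rewrite inE.
  rewrite !(E _ (fun A => [&& chain A, chain (set0 :\: A) & above v A])) ?ch0 ?set0D ?ch0 ?ab0 //.
  rewrite !(E _ (fun A => [&& chain A, chain (set0 :\: A) & above v (set0 :\: A)])) ?ch0 ?set0D ?ch0 ?ab0 //.
  rewrite !cards0 ascents0l !expr0 !mulr1.
  have -> : ascents [set v] set0 = 0%N by rewrite /ascents big_set1 big_set0.
  by rewrite expr0 !mulr1.
have [v' v'U lt_v'] := exists_min zU; pose U' := U :\ v'.
have UE : U = v' |: U' by rewrite setD1K.
have ltU'k : (#|U'| < k)%N.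
  by move: ltUk; rewrite UE cardsU1 !inE eqxx /=.
have [s IHs] := IH v' U' ltU'k lt_v' u w; rewrite -UE in IHs.
(* If [v] is below [v'] it is below all of [U] and forms a path by itself; the rest enters only
   through its full sum, symmetric by induction. *)
have [pvv'|npvv'] := boolP (prec v v').
  have pv x : x \in U -> prec v x.
    move=> xU; have [->|xv'] := eqVneq x v'; first by [].
    by apply: prec_mono pvv' _ => //; apply/ltnW/lt_v'; rewrite !inE xv'.
  have abv A : A \subset U -> above v A.
    by move=> /subsetP AU; apply/forall_inP => x /AU/pv.
  have inE' u' w' : bichain_sum (fun A => v \in A) u' w' (v |: U) = u' * bichain_sum xpredT u' w' U.
    rewrite bichain_sum_in // /bichain_sum big_distrr /=; apply: eq_big => [A|A].
      by case AU: (A \subset U) => //=; rewrite abv ?andbT.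
    case/and4P=> AU _ _ _; rewrite [ascents [set v] _]ascents_eq0 ?mulr1 //.
    by move=> x y /set1P-> /setDP[yU _]; rewrite /inc_ascent pv ?andbF.
  have outE' u' w' : bichain_sum (fun A => v \notin A) u' w' (v |: U) = w' * bichain_sum xpredT u' w' U.
    rewrite bichain_sum_out // /bichain_sum big_distrr /=; apply: eq_bigl => A.
    by case AU: (A \subset U) => //=; rewrite [above _ _]abv ?andbT // subsetDl.
  have symU : bichain_sum xpredT u w U = bichain_sum xpredT w u U.
    by rewrite !(bichain_sum_split v'); case: IHs => -[-> -> -> ->] //; rewrite addrC.
  by exists (bichain_sum xpredT u w U); left; rewrite !inE' !outE' symU.
(* If [v] is incomparable to [v'] only, it lengthens the first path by one vertex: [v] and [v'] lie
   in opposite chains, and the parity changes. *)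
have [far|near] := boolP (above v U').
  have lt_vv' := lt_v _ v'U.
  have inc_vv' : inc_ascent v v' by rewrite /inc_ascent lt_vv'.
  have pv x : x \in U -> prec v x = (x != v').
    by move=> xU; case: eqP => [->|/eqP ne]; [apply/negbTE | apply: (forall_inP far); rewrite !inE ne].
  have abv A : A \subset U -> above v A = (v' \notin A).
    move=> /subsetP AU; apply/forall_inP/idP => [h|h x xA].
      by apply/negP => /h; rewrite pv // eqxx.
    by rewrite pv ?AU //; apply: contraNneq h => <-.
  have inE' u' w' : bichain_sum (fun A => v \in A) u' w' (v |: U) =
      u' * q * bichain_sum (fun A => v' \notin A) u' w' U.
    rewrite bichain_sum_in // /bichain_sum big_distrr /=; apply: eq_big => [A|A].
      case AU: (A \subset U) => /=; last by rewrite andbF.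
      by rewrite abv // andbA andbC.
    case/and4P=> AU _ _; rewrite abv // => v'A.
    suff -> : ascents [set v] (U :\: A) = 1%N by [].
    rewrite /ascents big_set1 (big_setD1 v') ?inE ?v'A //= inc_vv' big1 // => x.
    by rewrite !inE => /and3P[xv' _ xU]; rewrite /inc_ascent pv // xv' andbF.
  have outE' u' w' : bichain_sum (fun A => v \notin A) u' w' (v |: U) =
      w' * bichain_sum (fun A => v' \in A) u' w' U.
    rewrite bichain_sum_out // /bichain_sum big_distrr /=; apply: eq_bigl => A.
    case AU: (A \subset U) => /=; last by rewrite andbF.
    by rewrite abv ?subsetDl // !inE v'U andbT negbK andbA andbC.
  rewrite !inE' !outE'; case: IHs => -[-> -> -> ->].
    by exists (u * w * s); right; split; ring.
  by exists (q * s); left; split; ring.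
(* Here [v], [v'] and [x] are pairwise incomparable, so two chains cannot cover them and all four
   sums vanish. *)
have [x xU' npvx] : exists2 x, x \in U' & ~~ prec v x.
  by move: near; rewrite negb_forall_in => /exists_inP[x]; exists x.
have xU : x \in U by rewrite UE !inE -in_setD1 -/U' xU' orbT.
have npv'x : ~~ prec v' x.
  by apply: contra npvx => pv'x; apply: prec_mono pv'x _; rewrite // ltnW ?lt_v.
have no A B : v' \in A :|: B -> x \in A :|: B -> chain A -> chain B -> above v A -> False.
  move=> + + /chainP cA /chainP cB /forall_inP vA.
  rewrite !inE; case/orP => [/vA|v'B]; first by rewrite (negbTE npvv').
  case/orP => [/vA|xB]; first by rewrite (negbTE npvx).
  by have := cB _ _ v'B xB (lt_v' _ xU'); rewrite (negbTE npv'x).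
have UA A : A \subset U -> A :|: U :\: A = U.
  by move=> /setIidPr AU; rewrite -{1}AU setID.
exists 0; left; rewrite !bichain_sum_in // !bichain_sum_out // !mulr0.
by split; apply: big1 => A /and4P[AU cA cD abv]; exfalso;
   [apply: (no A (U :\: A)) | apply: (no (U :\: A) A) | apply: (no A (U :\: A)) | apply: (no (U :\: A) A)] => //;
   rewrite ?[_ :\: A :|: _]setUC UA.
Qed.

Lemma bichain_sumC u w U : bichain_sum xpredT u w U = bichain_sum xpredT w u U.
Proof.
have [->|[z zU]] := set_0Vmem U.
  rewrite /bichain_sum; apply: eq_bigr => A /and4P[_ + _ _].
  by rewrite subset0 => /eqP->; rewrite set0D cards0.
have [v vU lt_v] := exists_min zU.
have [s] := bichain_sumC_pairs lt_v u w; rewrite setD1K // => IHs.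
by rewrite !(bichain_sum_split v); case: IHs => -[-> -> -> ->] //; rewrite addrC.
Qed.

End TwoChains.

(** * Independence of the order of the block sizes *)

Lemma coef_bivar (r : {poly int}) (i j k a b : nat) :
  ('X ^+ i * ('X%:P) ^+ j * (r%:P%:P) ^+ k : {poly {poly {poly int}}})`_a`_b =
  if (i == a) && (j == b) then r ^+ k else 0.
Proof.
rewrite -!polyC_exp -mulrA -polyCM mulrC coefCM coefXn eq_sym.
case: eqP => _; last by rewrite mulr0 coef0.
rewrite mulr1 coefMC coefXn eq_sym.
by case: eqP => _; rewrite ?mul1r ?mul0r.
Qed.

Lemma coef_bivarC (r : {poly int}) (i j k a b : nat) :
  (('X%:P) ^+ i * 'X ^+ j * (r%:P%:P) ^+ k : {poly {poly {poly int}}})`_a`_b =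
  if (i == b) && (j == a) then r ^+ k else 0.
Proof. by rewrite [X in X * _]mulrC coef_bivar andbC. Qed.

Lemma two_chainsC U a b : two_chains U a b = two_chains U b a.
Proof.
(* In the iterated polynomial ring the outer variable marks the first chain, the middle one the
   second, and the innermost is q. *)
have E c d : two_chains U c d = (bichain_sum ('X%:P%:P) xpredT 'X 'X%:P U)`_c`_d.
  rewrite /bichain_sum !coef_sum /two_chains.
  rewrite [RHS](eq_bigr _ (fun A _ => coef_bivar 'X _ _ _ c d)) -big_mkcondr /=.
  by apply: eq_bigl => A; rewrite -!andbA.
have E' c d : two_chains U c d = (bichain_sum ('X%:P%:P) xpredT 'X%:P 'X U)`_d`_c.
  rewrite /bichain_sum !coef_sum /two_chains.
  rewrite [RHS](eq_bigr _ (fun A _ => coef_bivarC 'X _ _ _ d c)) -big_mkcondr /=.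
  by apply: eq_bigl => A; rewrite -!andbA.
by rewrite E E' bichain_sumC.
Qed.

Lemma chain_count_swap W a b s : chain_count W [:: a, b & s] = chain_count W [:: b, a & s].
Proof. by rewrite !chain_count2; apply: eq_bigr => U _; rewrite two_chainsC. Qed.

Lemma chain_count_perm W s s' : perm_eq s s' -> chain_count W s = chain_count W s'.
Proof.
have mid W' a t1 t2 : chain_count W' (t1 ++ a :: t2) = chain_count W' (a :: t1 ++ t2).
  elim: t1 W' => // b t1 IH W'; rewrite !cat_cons chain_count_swap /=.
  by apply: eq_bigr => A _; rewrite IH.
elim: s s' W => [|a s IH] s' W ss'.
  by rewrite perm_sym in ss'; move/perm_nilP: ss' => ->.
have /splitPr sP : a \in s' by rewrite -(perm_mem ss') mem_head.
case: sP ss' => t1 t2; rewrite -[a :: t2]cat1s perm_sym perm_catCA /= perm_cons perm_sym => ss'.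
by rewrite mid /=; apply: eq_bigr => A _; rewrite (IH _ _ ss').
Qed.

(** * Removing a chain letter by letter *)

(** A nonempty chain is determined by its largest element and the chain strictly below it; this is
    the step from chains to decreasing words. *)
Lemma sum_chain_max U a (V : nmodType) (F : {set 'I_n} -> V) :
  \sum_(A : {set 'I_n} | [&& A \subset U, chain A & #|A| == a.+1]) F A =
  \sum_(x in U)
    \sum_(A : {set 'I_n} | [&& A \subset [set y in U | prec y x], chain A & #|A| == a]) F (x |: A).
Proof.
pose mx x A := (x \in A) && [forall y in A, (y <= x)%N].
transitivity (\sum_(A : {set 'I_n} | [&& A \subset U, chain A & #|A| == a.+1])
    \sum_(x in U | mx x A) F A).
  apply: eq_bigr => A /and3P[AU cA /eqP sA].
  have [z zA] : exists z, z \in A by apply/set0Pn; rewrite -card_gt0 sA.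
  case: (@arg_maxnP _ z (mem A) val zA) => x xA max_x.
  rewrite (big_pred1 x) // => y /=; rewrite /mx; apply/and3P/eqP => [[yU yA maxy]|->].
    apply/val_inj/eqP; rewrite eqn_leq; apply/andP; split; first exact: max_x.
    by have /forall_inP/(_ x xA) := maxy.
  by split; [apply: (subsetP AU) | | apply/forall_inP].
rewrite (exchange_big_dep (fun x => x \in U)) /=; last by move=> ? ? _ /andP[].
apply: eq_bigr => x xU.
rewrite (reindex_onto (fun A => x |: A) (fun A => A :\ x)) /=; last first.
  by move=> A /andP[_ /andP[_ /andP[xA _]]]; rewrite setD1K.
apply: eq_bigl => A; rewrite xU /= /mx setU11 /=; apply/idP/idP.
  case/andP=> /andP[/and3P[AU cA sA] /forall_inP maxx] /eqP eqA.
  have xA : x \notin A by rewrite -eqA !inE eqxx.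
  have Ax : A \subset x |: A := subsetUr _ _.
  rewrite (chain_sub Ax cA) andTb; move: sA; rewrite cardsU1 xA add1n eqSS => ->.
  rewrite andbT; apply/subsetP => y yA; rewrite inE (subsetP AU) ?(subsetP Ax) //=.
  move/chainP: cA; apply; rewrite ?setU11 ?(subsetP Ax) //.
  rewrite ltn_neqAle maxx ?(subsetP Ax) // andbT.
  by apply: contraNneq xA => /val_inj <-.
case/and3P=> /subsetP AU /chainP cA sA.
have lt_x y : y \in A -> [/\ y \in U, prec y x & (y < x)%N].
  by move=> /AU; rewrite inE => /andP[? pyx]; split=> //; apply: prec_lt.
have xA : x \notin A by apply/negP => /lt_x[_ _]; rewrite ltnn.
rewrite setU1K // eqxx andbT cardsU1 xA add1n eqSS sA andbT.
apply/andP; split; first (apply/andP; split).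
- by rewrite subUset sub1set xU; apply/subsetP => y /lt_x[].
- apply/chainP => y z /setU1P[->|yA] /setU1P[->|zA]; rewrite ?ltnn //.
  + by case: (lt_x _ zA) => _ _ zx xz; have := ltn_trans zx xz; rewrite ltnn.
  + by case: (lt_x _ yA).
  + exact: cA.
- by apply/forall_inP => y /setU1P[->|/lt_x[_ _ /ltnW]].
Qed.

Lemma prec_trans x y z : prec x y -> prec y z -> prec x z.
Proof. by move=> xy /prec_lt/ltnW yz; apply: prec_mono xy yz. Qed.

Definition peel (Q : pred 'I_n) a (F : {set 'I_n} -> {poly int}) W : {poly int} :=
  \sum_(A : {set 'I_n} | [&& A \subset [set x in W | Q x], chain A & #|A| == a])
    asc_weight A (W :\: A) * F (W :\: A).

(** The removed letters form a decreasing run in P. The continuation [G] receives the constraint set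
    by the last of them, so that it can prolong the run. *)
Fixpoint descend (Q : pred 'I_n) a (G : pred 'I_n -> {set 'I_n} -> {poly int}) W :
    {poly int} :=
  if a is a'.+1 then
    \sum_(x in W | Q x) asc_weight [set x] (W :\ x) * descend (prec^~ x) a' G (W :\ x)
  else G Q W.

Lemma descend_rec Q a G W : descend Q a.+1 G W =
  \sum_(x in W | Q x) asc_weight [set x] (W :\ x) * descend (prec^~ x) a G (W :\ x).
Proof. by []. Qed.

Definition down_closed (Q : pred 'I_n) := forall x y, prec x y -> Q y -> Q x.

Lemma down_closed_prec x : down_closed (prec^~ x).
Proof. by move=> y z; apply: prec_trans. Qed.

(** Removing the chain from the top down, each letter is larger than the chain elements still to
    come and has no ascent to them; the letter weights therefore multiply to the weight of the
    chain. Down-closedness reduces the condition on the chain to its top. *)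
Lemma peel_descend Q a F W :
  down_closed Q -> peel Q a F W = descend Q a (fun=> F) W.
Proof.
elim: a Q W => [|a IH] Q W Qdown.
  rewrite /peel (big_pred1 set0) => [|A] /=.
    by rewrite /asc_weight ascents0l setD0 expr0 mul1r.
  rewrite cards_eq0; case: (A =P set0) => [->|_]; rewrite ?andbF //= sub0set andbT /=.
  by apply/chainP => x y; rewrite inE.
rewrite /peel sum_chain_max /=.
rewrite (eq_bigl (fun x => (x \in W) && Q x)); last by move=> x; rewrite inE.
apply: eq_bigr => x /andP[xW Qx]; rewrite -IH; last exact: down_closed_prec.
rewrite /peel big_distrr /=.
have -> : [set y in [set z in W | Q z] | prec y x] = [set y in W :\ x | prec y x].
  apply/setP => y; rewrite !inE; case yx: (prec y x); rewrite ?andbF //= !andbT.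
  have -> : Q y by apply: Qdown yx Qx.
  by rewrite andbT; case: eqP => //= eyx; rewrite eyx in yx; have := prec_lt yx; rewrite ltnn.
apply: eq_bigr => A /and3P[/subsetP AW _ _].
have {}AW y : y \in A -> [/\ y \in W, y != x & prec y x].
  by move/AW; rewrite !inE => /andP[/andP[-> ->] ->].
have xA : x \notin A by apply/negP => /AW[_]; rewrite eqxx.
rewrite -setDDl mulrA /asc_weight -exprD; congr ('X^_ * _).
have dis : [disjoint [set x] & A] by rewrite disjoints1.
rewrite ascentsUl //; congr addn.
have AWx : A \subset W :\ x by apply/subsetP => y /AW[yW yx _]; rewrite !inE yx.
rewrite -[in RHS](setID (W :\ x) A) ascentsUr; last first.
  by rewrite -setI_eq0 setIC setDE -setIA; apply/eqP/setP => y; rewrite !inE; case: (y \in A); rewrite ?andbF.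
rewrite [X in (_ = X + _)%N]ascents_eq0 // => y z /set1P-> /setIP[_ /AW[_ _ zx]].
by rewrite /inc_ascent ltnNge ltnW // prec_lt.
Qed.

Lemma eq_descend Q a G G' W :
  (forall Q' W', (#|W'| + a)%N = #|W| -> G Q' W' = G' Q' W') ->
  descend Q a G W = descend Q a G' W.
Proof.
elim: a Q W => [|a IH] Q W eqG /=; first by apply: eqG; rewrite addn0.
apply: eq_bigr => x /andP[xW _]; congr (_ * _); apply: IH => Q' W' cW'; apply: eqG.
by rewrite (cardsD1 x W) xW -cW' addnS.
Qed.

Lemma descendB Q a G G' W :
  descend Q a (fun Q W => G Q W - G' Q W) W = descend Q a G W - descend Q a G' W.
Proof.
elim: a Q W => [|a IH] Q W //=; rewrite -sumrB; apply: eq_bigr => x _.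
by rewrite IH mulrBr.
Qed.

Lemma descendZ Q a c G W :
  descend Q a (fun Q W => c * G Q W) W = c * descend Q a G W.
Proof.
elim: a Q W => [|a IH] Q W //=; rewrite mulr_sumr; apply: eq_bigr => x _.
by rewrite IH mulrCA.
Qed.

Lemma descendS Q a G W :
  descend Q a.+1 G W = descend Q a (fun Q => descend Q 1 G) W.
Proof.
elim: a Q W => [|a IH] Q W //=; apply: eq_bigr => x _; congr (_ * _).
exact: IH.
Qed.

(** * Words without descents and without bottom letters *)

(** No weight appears because an element below all the others has no ascent to them. *)
Definition bottom_sum (F : {set 'I_n} -> {poly int}) (Q : pred 'I_n) W : {poly int} :=
  \sum_(z in W | Q z && above z (W :\ z)) F (W :\ z).

(** An element below the last removed letter and below all that remains is below all of [W], so it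
    can be removed first; being smaller than the other letters, it receives no ascent from them. *)
Lemma descend_bottom F Q a W : down_closed Q ->
  descend Q a (bottom_sum F) W =
  \sum_(z in W | Q z && above z (W :\ z)) descend Q a (fun=> F) (W :\ z).
Proof.
elim: a Q W => [|a IH] Q W Qdown //=.
transitivity (\sum_(x in W | Q x) \sum_(z in W :\ x | prec z x && above z (W :\ x :\ z))
   asc_weight [set x] (W :\ x) * descend (prec^~ x) a (fun=> F) (W :\ x :\ z)).
  by apply: eq_bigr => x _; rewrite IH ?big_distrr //; apply: down_closed_prec.
rewrite (exchange_big_dep (fun z => (z \in W) && (Q z && above z (W :\ z)))) /=.
  apply: eq_bigr => z /andP[zW /andP[Qz abz]]; apply: eq_big => [x|x /andP[/andP[xW Qx] /andP[zWx /andP[zx _]]]].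
    rewrite !inE zW andbT; case: eqP => [->|/eqP zx]; first by rewrite eqxx !andbF.
    rewrite eq_sym zx /=; case xW: (x \in W) => //=; case: (Q x) => //=.
    have pzx : prec z x by apply: (forall_inP abz); rewrite !inE eq_sym zx.
    rewrite pzx; apply/forall_inP => y; rewrite !inE => /and3P[yz _ yW].
    by apply: (forall_inP abz); rewrite !inE yz.
  have -> : W :\ z :\ x = W :\ x :\ z by rewrite !setDDl setUC.
  have Wx : W :\ x = z |: (W :\ x :\ z) by rewrite setD1K.
  congr ('X^_ * _); rewrite {1}Wx.
  rewrite ascentsUr ?disjoints1 ?inE ?eqxx // ascents_eq0 // => u v /set1P-> /set1P->.
  by rewrite /inc_ascent ltnNge ltnW // prec_lt.
move=> x z /andP[xW Qx] /andP[]; rewrite !inE => /andP[zx zW] /andP[pzx /forall_inP abz].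
rewrite zW (Qdown _ _ pzx Qx) /=; apply/forall_inP => y; rewrite !inE => /andP[yz yW].
by have [->//|yx] := eqVneq y x; apply: abz; rewrite !inE yz yx.
Qed.

(* The words counted have no descent w_i > w_(i+1) in P, and no letter other
   than the last one is below all the letters that follow it. *)
Fixpoint word_count k W y : {poly int} :=
  if k is k'.+1 then
    asc_weight [set y] (W :\ y) *
    (if W :\ y == set0 then 1 else if above y (W :\ y) then 0 else
     \sum_(z in W :\ y | ~~ prec z y) word_count k' (W :\ y) z)
  else 0.

(** A word uses each element of [W] once, so [#|W|] is exactly the fuel that it needs. *)
Definition words_in (Q : pred 'I_n) W := \sum_(z in W | Q z) word_count #|W| W z.

Notation words := (words_in xpredT).

(** A word on [W] cannot follow [y] if it starts with a descent from [y] or if [y] is below all of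
    [W]. The two reasons exclude each other, since in the second case no letter of [W] is below
    [y]. *)
Lemma words_split y W :
  (if above y W then 0 else \sum_(z in W | ~~ prec z y) word_count #|W| W z) =
  words W - words_in (prec^~ y) W - (if above y W then words W else 0).
Proof.
have -> : words W = words_in (prec^~ y) W + \sum_(z in W | ~~ prec z y) word_count #|W| W z.
  rewrite /words_in (bigID (fun z => prec z y)) /=.
  by congr (_ + _); apply: eq_bigl => z; rewrite andbT.
case: ifP => [aby|_]; last by ring.
suff -> : words_in (prec^~ y) W = 0 by ring.
apply: big1 => z /andP[zW pzy]; have := prec_lt (prec_trans pzy (forall_inP aby z zW)).
by rewrite ltnn.
Qed.

(** Inclusion-exclusion on the first letter. At least two elements are required because the last
    letter is exempt from the condition on bottom letters. *)
Lemma words_in_step Q W : (1 < #|W|)%N ->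
  words_in Q W = descend Q 1 (fun=> words) W - descend Q 1 words_in W - bottom_sum words Q W.
Proof.
move=> W2; rewrite {1}/words_in /bottom_sum /=.
rewrite [X in _ - _ - X](eq_bigl (fun z => ((z \in W) && Q z) && above z (W :\ z))); last first.
  by move=> z; rewrite /= andbA.
rewrite [X in _ - _ - X]big_mkcondr -!sumrB; apply: eq_bigr => y /andP[yW _] /=.
rewrite -(prednK (ltnW W2)) /=.
have cW : #|W :\ y| = #|W|.-1 by rewrite (cardsD1 y W) yW.
have /negbTE-> : W :\ y != set0 by rewrite -card_gt0 cW -subn1 subn_gt0.
rewrite -cW words_split mulrBr mulrBr; congr (_ - _ - _).
case: ifP => [/forall_inP aby|_]; last by rewrite mulr0.
rewrite /asc_weight ascents_eq0 ?expr0 ?mul1r // => u v /set1P-> vW.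
by rewrite /inc_ascent aby // andbF.
Qed.

Lemma words_set1 W : #|W| = 1%N -> words_in xpredT W = 1.
Proof.
move=> W1; rewrite /words_in W1; case/eqP/cards1P: W1 => x ->.
rewrite (big_pred1 x) => [|y]; last by rewrite !inE andbT.
by rewrite /= setDv eqxx mulr1 /asc_weight /ascents big_set1 big_set0.
Qed.

(** The middle term has the form of the left side with a longer run, so iteration produces the
    alternating sum of Newton's identities. *)
Lemma descend_words_in Q a W : (a.+1 < #|W|)%N ->
  descend Q a words_in W = descend Q a.+1 (fun=> words) W
    - descend Q a.+1 words_in W - descend Q a (bottom_sum words) W.
Proof.
move=> aW; rewrite [descend _ a.+1 (fun=> words) _]descendS [descend _ a.+1 words_in _]descendS.
rewrite -!descendB; apply: eq_descend => Q' W' cW'; apply: words_in_step.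
by rewrite -(ltn_add2r a) cW'.
Qed.

(** The one remaining letter completes the run to a chain covering [W]; this is where the iteration
    yields e_k. *)
Lemma descend_words_in_top Q a W : #|W| = a.+1 ->
  descend Q a words_in W = descend Q a.+1 (fun _ _ => 1) W.
Proof.
move=> cW; rewrite descendS; apply: eq_descend => Q' W' /eqP.
rewrite cW addnC -addn1 eqn_add2l /words_in => /eqP cW'; rewrite cW'.
apply: eq_bigr => z /andP[zW' _] /=.
have /eqP-> : W' :\ z == set0 by rewrite -cards_eq0 -(eqn_add2l 1%N) -[X in (X + _)%N]/(true : nat) -zW' -cardsD1 cW'.
by rewrite eqxx.
Qed.

Lemma descend_bottom_top Q a W : #|W| = a.+1 ->
  descend Q a (bottom_sum (fun=> 1)) W = descend Q a.+1 (fun _ _ => 1) W.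
Proof.
move=> cW; rewrite [RHS]descendS; apply: eq_descend => Q' W' /eqP.
rewrite cW addnC -addn1 eqn_add2l /bottom_sum => /cards1P[x ->] /=.
rewrite (eq_bigl (fun z => (z \in [set x]) && Q' z)).
  apply: eq_bigr => z /andP[/set1P-> _].
  by rewrite setDv /asc_weight ascents_eq0 ?expr0 ?mul1r // => u v _; rewrite inE.
move=> z /=; case zx: (z \in [set x]) => //=.
rewrite (set1P zx) setDv; have -> : above x set0 by apply/forall_inP => y; rewrite inE.
by rewrite andbT.
Qed.

(** * Newton's identities for words *)

(** The bounce blocks will supply this map; its strict growth along [prec] bounds the chains by
    three elements. *)
Variable level : 'I_n -> nat.
Hypothesis level_lt : forall x, (level x < 3)%N.
Hypothesis level_prec : forall x y, prec x y -> (level x < level y)%N.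

Lemma chain_card A : chain A -> (#|A| <= 3)%N.
Proof.
move=> /chainP cA; pose f x : 'I_3 := Ordinal (level_lt x).
rewrite -[3%N]card_ord -(card_in_imset (f := f)) ?max_card // => x y xA yA fxy.
have {}fxy : level x = level y by have := congr1 val fxy.
apply/val_inj; case: (ltngtP x y) => // xy.
  by have := level_prec (cA _ _ xA yA xy); rewrite fxy ltnn.
by have := level_prec (cA _ _ yA xA xy); rewrite fxy ltnn.
Qed.

Lemma peel_gt3 Q a F W : (3 < a)%N -> peel Q a F W = 0.
Proof.
move=> a3; rewrite /peel big1 // => A /and3P[_ /chain_card cA /eqP sA].
by move: cA; rewrite sA leqNgt a3.
Qed.

(** Three removed letters followed by a smaller one would be a chain of four elements, so the
    iteration stops here. *)
Lemma descend_words_in0 W : descend xpredT 3 words_in W = 0.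
Proof.
have below x a W' : (level x <= a)%N -> descend (prec^~ x) a words_in W' = 0.
  elim: a x W' => [|a IH] x W' la /=; apply: big1 => z /andP[_ /level_prec zx].
    by move: la; rewrite leqNgt (leq_ltn_trans _ zx).
  by rewrite IH ?mulr0 //; rewrite -ltnS (leq_trans zx).
by rewrite descend_rec; apply: big1 => x _; rewrite below ?mulr0 //; rewrite -ltnS.
Qed.

(** The lowest level is taken by elements such as [z], which leaves only two levels for [W]. *)
Lemma descend3_above z F W : above z W -> descend xpredT 3 (fun=> F) W = 0.
Proof.
move=> /forall_inP abz.
have {abz} lev1 x : x \in W -> (0 < level x)%N.
  by move=> /abz/level_prec; apply: leq_ltn_trans.
have below x a W' : W' \subset W -> (level x <= a.+1)%N ->
    descend (prec^~ x) a.+1 (fun=> F) W' = 0.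
  elim: a x W' => [|a IH] x W' W'W la; rewrite descend_rec; apply: big1 => y /andP[yW' /level_prec yx].
    have := lev1 _ (subsetP W'W _ yW').
    by rewrite lt0n -leqn0 -ltnS (leq_trans yx).
  have W'y : W' :\ y \subset W := subset_trans (subsetDl _ _) W'W.
  by rewrite (IH _ _ W'y) ?mulr0 // -ltnS (leq_trans yx).
by rewrite descend_rec; apply: big1 => x _; rewrite below ?mulr0 ?subsetDl //; rewrite -ltnS.
Qed.

(** The value at the empty set is p_0 = 3, the number of variables, as needed for e_3 p_0 in
    Newton's identity for p_3. *)
Definition words3 W : {poly int} := if W == set0 then 3 else words W.

(** The chain of two elements is subtracted twice: read downwards it is a descent, read upwards its
    first letter is below the rest. *)
Lemma words_newton2 W : #|W| = 2%N ->
  words W = descend xpredT 1 (fun=> words) W - 2 * descend xpredT 2 (fun _ _ => 1) W.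
Proof.
move=> cW; rewrite -[LHS]/(descend xpredT 0 words_in W) descend_words_in ?cW //.
rewrite descend_words_in_top //=.
suff -> : bottom_sum words xpredT W = descend xpredT 2 (fun _ _ => 1) W by rewrite /=; ring.
rewrite -descend_bottom_top // descend_bottom //; apply: eq_bigr => z /andP[zW _].
have cWz : #|W :\ z| = 1%N by move: cW; rewrite (cardsD1 z W) zW => -[].
rewrite words_set1 // -[RHS]descend_words_in_top //=; exact/esym/words_set1.
Qed.

(* Attaching a chain before a word either gives a word, or creates a descent,
   which moves the first letter of the word to the chain, or puts an element z
   below everything else; the last contribution cancels by the identity for
   W minus z, where no chain has three elements. *)
Lemma words_newton W : (2 < #|W|)%N ->
  words W = descend xpredT 1 (fun=> words) W - descend xpredT 2 (fun=> words) W
    + descend xpredT 3 (fun=> words3) W.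
Proof.
have [k] := ubnP #|W|; elim: k W => // k IH W ltWk W3.
have cWD z : z \in W -> #|W| = #|W :\ z|.+1 by move=> zW; rewrite (cardsD1 z W) zW.
rewrite -[LHS]/(descend xpredT 0 words_in W) descend_words_in; last exact: ltnW.
rewrite descend_words_in // !descend_bottom //.
case: (ltngtP #|W| 3%N) => [|W4|cW]; first by rewrite ltnNge W3.
  rewrite descend_words_in // descend_words_in0 descend_bottom //.
  rewrite (@eq_descend _ 3 (fun=> words3) (fun=> words)); last first.
    move=> _ W' cW'; rewrite /words3 -cards_eq0; case: eqP => // W0.
    by move: W4; rewrite -cW' W0.
  set b0 := \sum_(z in W | _) _; set b1 := \sum_(z in W | _) _; set b2 := \sum_(z in W | _) _.
  suff : b0 - b1 + b2 = 0 by move=> b0E; rewrite -[b1 in LHS]addr0 -{2}b0E; ring.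
  rewrite /b0 /b1 /b2 -sumrB -big_split; apply: big1 => z /andP[zW abz].
  have ltz : (#|W :\ z| < k)%N by rewrite -ltnS -cWD.
  have gtz : (2 < #|W :\ z|)%N by rewrite -ltnS -cWD.
  rewrite [descend xpredT 0 _ _]/= (IH _ ltz gtz).
  rewrite (descend3_above words3 abz) addr0.
  by set p2 := descend _ 2 _ _; set p1 := descend _ 1 _ _; rewrite /=; ring.
rewrite descend_words_in_top //.
have -> : descend xpredT 3 (fun=> words3) W = 3 * descend xpredT 3 (fun _ _ => 1) W.
  rewrite -(descendZ xpredT 3 3 (fun _ _ => 1)); apply: eq_descend => _ W' cW'; rewrite /words3 mulr1.
  have -> : W' == set0 by rewrite -cards_eq0 -(eqn_add2r 3%N) cW' cW.
  by [].
set b0 := \sum_(z in W | _) _; set b1 := \sum_(z in W | _) _.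
(* One of the three copies of e_3 has come from the decreasing words. The other two come from bottom
   elements: without its bottom, a chain of three is a chain of two, counted twice by
   [words_newton2]. *)
suff b0E : b0 - b1 = 2 * descend xpredT 3 (fun _ _ => 1) W by rewrite -[b0](subrK b1) b0E; ring.
rewrite -descend_bottom_top // descend_bottom // mulr_sumr -sumrB; apply: eq_bigr => z /andP[zW _].
have cWz : #|W :\ z| = 2%N by apply/eqP; rewrite -eqSS -cWD // cW.
rewrite [descend xpredT 0 _ _]/= words_newton2 //.
by set p1 := descend _ 1 _ _; set p2 := descend _ 2 _ _; ring.
Qed.

(** * The functional on polynomials in e_1, e_2, e_3 *)

Definition block_sizes (m : 'X_{1..3}) : seq nat :=
  flatten [seq nseq (m i) i.+1 | i : 'I_3].

(* [gen a] stands for e_a(t_1, t_2, t_3), so it vanishes for a > 3. *)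
Definition gen a : {mpoly {poly int}[3]} :=
  if a is a'.+1 then oapp (fun i : 'I_3 => 'X_i) 0 (insub a') else 1.

(* Linear, sends e_1^i e_2^j e_3^k to the weighted number of ordered partitions
   of W into i chains of size 1, j of size 2 and k of size 3; the truncation
   loses nothing, as monomials of degree above n count no partition. *)
Definition chain_eval W (f : {mpoly {poly int}[3]}) : {poly int} :=
  \sum_(m : 'X_{1..3 < n.+1}) f@_m * chain_count W (block_sizes m).

Lemma count_block_sizes (p : pred nat) m : count p (block_sizes m) = (\sum_(i < 3) p i.+1 * m i)%N.
Proof.
rewrite /block_sizes count_flatten -map_comp sumnE big_map /=.
rewrite -[RHS]big_enum /=; apply: eq_bigr => i _.
by rewrite /= count_nseq.
Qed.

Lemma block_sizes_perm (i : 'I_3) m : perm_eq (block_sizes (U_(i) + m)) (i.+1 :: block_sizes m).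
Proof.
apply/seq.permP => p /=; rewrite !count_block_sizes.
under eq_bigr do rewrite mnmDE mulnDr.
rewrite big_split /=; congr addn; rewrite (bigD1 i) //= mnmE eqxx muln1 big1 ?addn0 //.
by move=> j ji; rewrite mnmE eq_sym (negbTE ji) muln0.
Qed.

Lemma block_sizes0 : block_sizes 0 = [::].
Proof.
apply/perm_nilP; apply/seq.permP => p; rewrite count_block_sizes big1 // => i _.
by rewrite mnm0E muln0.
Qed.

Lemma sumn_block_sizes m : sumn (block_sizes m) = (\sum_(i < 3) i.+1 * m i)%N.
Proof.
rewrite /block_sizes sumn_flatten -map_comp sumnE big_map -[RHS]big_enum /=.
by apply: eq_bigr => i _; rewrite /= sumn_nseq.
Qed.

Lemma chain_evalD W f g : chain_eval W (f + g) = chain_eval W f + chain_eval W g.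
Proof.
by rewrite /chain_eval -big_split; apply: eq_bigr => m _; rewrite mcoeffD mulrDl.
Qed.

Lemma chain_evalZ W c f : chain_eval W (c *: f) = c * chain_eval W f.
Proof.
by rewrite /chain_eval mulr_sumr; apply: eq_bigr => m _; rewrite mcoeffZ mulrA.
Qed.

Lemma chain_eval0 W : chain_eval W 0 = 0.
Proof. by rewrite -(scale0r 0) chain_evalZ mul0r. Qed.

Lemma chain_evalB W f g : chain_eval W (f - g) = chain_eval W f - chain_eval W g.
Proof. by rewrite -scaleN1r chain_evalD chain_evalZ mulN1r. Qed.

Lemma chain_evalMn W f k : chain_eval W (f *+ k) = chain_eval W f *+ k.
Proof. by rewrite -scaler_nat chain_evalZ mulr_natl. Qed.

Lemma chain_eval_sum W (I : Type) (r : seq I) (P : pred I) F :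
  chain_eval W (\sum_(i <- r | P i) F i) = \sum_(i <- r | P i) chain_eval W (F i).
Proof.
by apply: (big_morph (chain_eval W)); [apply: chain_evalD | apply: chain_eval0].
Qed.

Lemma chain_evalX W m : chain_eval W 'X_[m] = chain_count W (block_sizes m).
Proof.
have [mn|mn] := ltnP (mdeg m) n.+1.
  rewrite /chain_eval (bigD1 (BMultinom mn)) //= mcoeffX eqxx mul1r big1 ?addr0 // => m' ne.
  rewrite mcoeffX; case: eqP => [mm'|_]; last by rewrite mul0r.
  by case/eqP: ne; apply: val_inj.
rewrite chain_count_size.
  rewrite /chain_eval big1 // => m' _; rewrite mcoeffX; case: eqP => [mm'|_]; last by rewrite mul0r.
  by have := bmdeg m'; rewrite -mm' ltnNge mn.
rewrite sumn_block_sizes; apply: contraTneq mn => e; rewrite -ltnNge ltnS.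
apply: (@leq_trans #|W|); last by rewrite -[leqRHS]card_ord max_card.
by rewrite -e mdegE; apply: leq_sum => i _; rewrite leq_pmull.
Qed.

Lemma chain_eval1 W : chain_eval W 1 = (W == set0)%:R.
Proof. by rewrite -mpolyX0 chain_evalX block_sizes0. Qed.

(** Multiplying by e_a adds a block of size a to the list, and [chain_count_perm] allows it to be
    the first one removed. For [a > 3] both sides vanish. *)
Lemma chain_eval_gen W a f :
  chain_eval W (gen a * f) = descend xpredT a (fun=> chain_eval^~ f) W.
Proof.
rewrite -peel_descend //.
have E : peel xpredT a (chain_eval^~ f) W =
    \sum_(m <- msupp f) f@_m * peel xpredT a (fun W => chain_count W (block_sizes m)) W.
  rewrite /peel; under [RHS]eq_bigr do rewrite mulr_sumr.
  rewrite exchange_big /=; apply: eq_bigr => A _.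
  rewrite {1}[f]mpolyE chain_eval_sum mulr_sumr; apply: eq_bigr => m _.
  by rewrite chain_evalZ chain_evalX mulrCA.
rewrite E {1}[f]mpolyE mulr_sumr chain_eval_sum; apply: eq_bigr => m _.
rewrite -scalerAr chain_evalZ; congr (_ * _).
have cntE : peel xpredT a (fun W => chain_count W (block_sizes m)) W = chain_count W (a :: block_sizes m).
  have WT : [set x in W | xpredT x] = W by apply/setP => x; rewrite !inE andbT.
  by rewrite /peel WT.
case: a cntE {E} => [|a] cntE.
  by rewrite mul1r chain_evalX cntE chain_count0.
rewrite /gen; case: insubP => [i _ ia|a3] /=.
  rewrite -mpolyXD chain_evalX cntE -ia; apply: chain_count_perm; exact: block_sizes_perm.
by rewrite mul0r chain_eval0 peel_gt3 // ltnS leqNgt.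
Qed.

(* Newton's identities: [power_sum k] is p_k as a polynomial in e_1, e_2, e_3. *)
Fixpoint power_sum (k : nat) : {mpoly {poly int}[3]} :=
  match k with
  | 0 => 3
  | k1.+1 => match k1 with
    | 0 => gen 1
    | k2.+1 => match k2 with
      | 0 => gen 1 * gen 1 - 2 * gen 2
      | k3.+1 => gen 1 * power_sum k1 - gen 2 * power_sum k2 + gen 3 * power_sum k3
      end
    end
  end.

Lemma words3_gt0 W : (0 < #|W|)%N -> words3 W = words W.
Proof. by rewrite /words3 card_gt0 => /negbTE->. Qed.

(** Both sides obey the same recursion. The index is [#|W|] because [chain_eval W] only sees
    monomials whose block sizes add up to [#|W|]. *)
Lemma chain_eval_power_sum W : chain_eval W (power_sum #|W|) = words3 W.
Proof.
have [k] := ubnP #|W|; elim: k W => // k IH W ltWk.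
have power a j : #|W| = (a.+1 + j)%N ->
    descend xpredT a.+1 (fun=> chain_eval^~ (power_sum j)) W = descend xpredT a.+1 (fun=> words3) W.
  move=> cW; apply: eq_descend => _ W' cW'.
  have <- : #|W'| = j by apply/eqP; rewrite -(eqn_add2r a.+1) cW' cW addnC.
  by apply: IH; rewrite -ltnS (leq_trans _ ltWk) // ltnS -cW' addnS ltnS leq_addr.
have one a : #|W| = a -> descend xpredT a (fun=> chain_eval^~ 1) W = descend xpredT a (fun _ _ => 1) W.
  move=> cW; apply: eq_descend => _ W' /eqP.
  by rewrite cW -[X in _ == X]add0n eqn_add2r cards_eq0 chain_eval1 => ->.
have words_descend a : (a < #|W|)%N -> descend xpredT a (fun=> words3) W = descend xpredT a (fun=> words) W.
  move=> aW; apply: eq_descend => _ W' cW'; apply: words3_gt0.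
  by rewrite -(ltn_add2r a) cW' add0n.
case cW: #|W| => [|[|[|j]]].
- have W0 : W == set0 by rewrite -cards_eq0 cW.
  by rewrite /words3 W0 chain_evalMn chain_eval1 W0.
- rewrite words3_gt0 ?cW // -[power_sum 1]/(gen 1) -[gen 1]mulr1 chain_eval_gen one //.
  by rewrite -descend_words_in_top.
- rewrite words3_gt0 ?cW // words_newton2 // -[power_sum 2]/(gen 1 * gen 1 - 2 * gen 2).
  rewrite chain_evalB mulr_natl chain_evalMn mulr_natl.
  rewrite chain_eval_gen -[gen 2]mulr1 chain_eval_gen one //; congr (_ - _).
  by rewrite -[gen 1]/(power_sum 1) power // words_descend // cW.
rewrite words3_gt0 ?cW // words_newton ?cW //.
rewrite -[power_sum _]/(gen 1 * power_sum j.+2 - gen 2 * power_sum j.+1 + gen 3 * power_sum j).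
rewrite chain_evalD chain_evalB !chain_eval_gen !power //.
by rewrite (words_descend 1%N) ?(words_descend 2%N) ?cW.
Qed.

(** * Positivity *)

Lemma asc_weight_nat A B : asc_weight A B \is a polyOver Num.nat.
Proof. exact: nat_polyXn. Qed.

Lemma word_count_nat k W y : word_count k W y \is a polyOver Num.nat.
Proof.
elim: k W y => [|k IH] W y /=; first exact: polyOver0.
apply: nat_polyM; first exact: asc_weight_nat.
case: ifP => _; first exact: (nat_polyXn 0).
by case: ifP => _; [exact: polyOver0 | apply: nat_poly_sum].
Qed.

Lemma words_in_nat Q W : words_in Q W \is a polyOver Num.nat.
Proof. by apply: nat_poly_sum => z _; apply: word_count_nat. Qed.

Lemma descend_nat Q a G W :
  (forall Q' W', (#|W'| + a)%N = #|W| -> G Q' W' \is a polyOver Num.nat) -> descend Q a G W \is a polyOver Num.nat.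
Proof.
elim: a Q W => [|a IH] Q W Gnat /=; first by apply: Gnat; rewrite addn0.
apply: nat_poly_sum => x /andP[xW _]; apply: nat_polyM; first exact: asc_weight_nat.
apply: IH => Q' W' cW'; apply: Gnat.
by rewrite (cardsD1 x W) xW -cW' addnS.
Qed.

Lemma chain_eval_gen_nat W a : chain_eval W (gen a) \is a polyOver Num.nat.
Proof.
rewrite -[gen a]mulr1 chain_eval_gen; apply: descend_nat => _ W' _.
by rewrite chain_eval1 nat_poly_bool.
Qed.

(* p_1 p_k - p_(k+1) = m_(k,1) counts the words whose first letter either makes
   a descent or is below all other letters. *)
Lemma chain_eval_mono_nat W k : (1 < k)%N -> #|W| = k.+1 ->
  chain_eval W (gen 1 * power_sum k - power_sum k.+1) \is a polyOver Num.nat.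
Proof.
move=> k1 cW; rewrite chain_evalB chain_eval_gen -cW chain_eval_power_sum.
rewrite words3_gt0 ?cW // -[words W]/(descend xpredT 0 words_in W) descend_words_in ?cW //; last exact: ltnW.
rewrite (@eq_descend _ _ (fun=> chain_eval^~ (power_sum k)) (fun=> words)); last first.
  move=> _ W' /eqP; rewrite cW addn1 eqSS => /eqP cW'.
  by rewrite -cW' chain_eval_power_sum words3_gt0 // cW' ltnW.
rewrite -addrA -opprD opprB addrCA subrr addr0 /=.
apply: nat_polyD; last by apply: nat_poly_sum => z _; apply: words_in_nat.
by apply: (@descend_nat _ 1) => *; apply: words_in_nat.
Qed.

Lemma chain_eval_gen3_nat W l f :
  (forall W', (#|W'| + 3 * l)%N = #|W| -> chain_eval W' f \is a polyOver Num.nat) ->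
  chain_eval W (gen 3 ^+ l * f) \is a polyOver Num.nat.
Proof.
elim: l W => [|l IH] W fnat; first by rewrite mul1r; apply: fnat; rewrite muln0 addn0.
rewrite exprS -mulrA chain_eval_gen; apply: descend_nat => _ W' cW'.
by apply: IH => W'' cW''; apply: fnat; rewrite mulnS addnCA addnC cW''.
Qed.

(** * Colorings as ordered partitions into chains *)

Section Colorings.

Variables (N : nat) (c0 : 'I_N) (s : seq nat).
Implicit Types (c : 'I_N) (kappa : {ffun 'I_n -> 'I_N}).

Definition color_class W kappa c := [set v in W | kappa v == c].

(* [c0] is a placeholder color for the elements outside of W. *)
Definition colors_from m W kappa :=
  [forall v, if v \in W then (m <= kappa v)%N else kappa v == c0] &&
  [forall c : 'I_N, (m <= c)%N ==>
     (chain (color_class W kappa c) && (#|color_class W kappa c| == nth 0%N s c))].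

Definition color_ascents W kappa : nat :=
  \sum_(x in W) \sum_(y in W) (inc_ascent x y && (kappa x < kappa y)%N).

Lemma color_ascentsD m A W kappa :
  A \subset W -> (forall v, v \in A -> kappa v = m :> nat) ->
  (forall v, v \in W :\: A -> (m < kappa v)%N) ->
  color_ascents W kappa = (ascents A (W :\: A) + color_ascents (W :\: A) kappa)%N.
Proof.
move=> AW kA kW; have WE : W = A :|: W :\: A by rewrite -{1}(setIidPr AW) setID.
have dis : [disjoint A & W :\: A].
  by rewrite disjoint_sym; have := subxx (W :\: A); rewrite subsetD => /andP[].
rewrite /color_ascents {1}WE sum_setU_disjoint //; congr addn.
  apply: eq_bigr => x xA; rewrite {1}WE sum_setU_disjoint //= big1 ?add0n.
    by apply: eq_bigr => y yWA; rewrite (kA x xA) kW // andbT.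
  by move=> y yA; rewrite !kA // ltnn andbF.
apply: eq_bigr => x xWA; rewrite {1}WE sum_setU_disjoint //= big1 ?add0n //.
by move=> y yA; rewrite (kA y yA) ltnNge ltnW ?kW // andbF.
Qed.

(** Induction on the number of colors still available. The class of the least color [m] is the first
    block, and all bichromatic ascents that involve it start in it. *)
Lemma sum_colors_from m W : size s = N -> (m <= N)%N ->
  \sum_(kappa | colors_from m W kappa) ('X^(color_ascents W kappa) : {poly int}) =
  chain_count W (drop m s).
Proof.
move=> sN mN; have [k kN] : exists k, (k + m)%N = N by exists (N - m)%N; rewrite subnK.
elim: k m W kN {mN} => [|k IH] m W kN.
  rewrite add0n in kN; rewrite drop_oversize ?sN ?kN //=.
  have [->|[v vW]] := set_0Vmem W.
    rewrite (big_pred1 [ffun=> c0]) => [|kappa /=].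
      by rewrite eqxx /color_ascents big_set0.
    apply/andP/eqP => [[/forallP k0 _]|->].
      by apply/ffunP => v; have := k0 v; rewrite inE ffunE => /eqP.
    split; first by apply/forallP => v; rewrite inE ffunE.
    by apply/forallP => c; rewrite leqNgt ltn_ord.
  rewrite big_pred0 => [|kappa].
    by case: eqP vW => // ->; rewrite inE.
  apply/negP => /andP[/forallP/(_ v)]; rewrite vW leqNgt.
  by rewrite ltn_ord.
have mN : (m < N)%N by rewrite -kN addSn ltnS leq_addl.
pose c := Ordinal mN.
rewrite (drop_nth 0%N) ?sN //=.
rewrite (partition_big (fun kappa => color_class W kappa c)
   (fun A : {set 'I_n} => [&& A \subset W, chain A & #|A| == nth 0%N s m])) /=; last first.
  move=> kappa /andP[_ /forallP/(_ c)]; rewrite leqnn /= => ->; rewrite andbT.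
  by apply/subsetP => v; rewrite inE => /andP[].
apply: eq_bigr => A /and3P[AW cA sA].
rewrite -IH ?addnS -?addSn // big_distrr /=.
(* Colorings of [W] whose class of color [m] is [A] correspond to colorings of [W :\: A], in which
   [A] carries the placeholder color. *)
rewrite (reindex_onto (fun kappa => [ffun v => if v \in A then c else kappa v])
   (fun kappa => [ffun v => if v \in A then c0 else kappa v])) /=; last first.
  move=> kappa /andP[_ /eqP AE]; apply/ffunP => v; rewrite !ffunE.
  by case vA: (v \in A) => //; move: vA; rewrite -AE inE => /andP[_ /eqP->].
have vWA v : v \in W :\: A -> (v \in W) /\ (v \in A) = false.
  by rewrite inE => /andP[/negbTE-> ->].
pose f (kappa : {ffun 'I_n -> 'I_N}) := [ffun v => if v \in A then c else kappa v].
have f_gt kappa v : colors_from m W (f kappa) -> color_class W (f kappa) c = A ->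
    v \in W :\: A -> (m < kappa v)%N.
  move=> /andP[/forallP/(_ v) + _] AE /vWA[vW vA].
  rewrite vW ffunE vA leq_eqVlt => /orP[/eqP mv|//].
  by move: vA; rewrite -AE inE vW ffunE; case: ifP => // _; rewrite -val_eqE /= -mv eqxx.
have class_f kappa c' : (m < c')%N -> color_class W (f kappa) c' = color_class (W :\: A) kappa c'.
  move=> mc'; apply/setP => v; rewrite !inE ffunE; case: ifP => vA //=.
  by rewrite -val_eqE /= ltn_eqF ?andbF.
apply: eq_big => [kappa|kappa /andP[/andP[colW /eqP AE] _]]; last first.
  rewrite -exprD (@color_ascentsD m A) //.
  - congr ('X^(_ + _)); apply: eq_bigr => x xWA; apply: eq_bigr => y yWA.
    by rewrite !ffunE (vWA _ xWA).2 (vWA _ yWA).2.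
  - by move=> v vA; rewrite ffunE vA.
  - by move=> v vWA'; rewrite ffunE (vWA _ vWA').2; apply: f_gt colW AE vWA'.
apply/idP/idP.
  case/andP=> /andP[colW /eqP AE] /eqP kE.
  rewrite /colors_from; apply/andP; split; [apply/forallP => v | apply/forallP => c'].
    case: ifP => [vW|]; first exact: f_gt colW AE vW.
    rewrite inE => /negbT; rewrite negb_and negbK => vAW.
    have [vA|vA] := boolP (v \in A).
      by rewrite -kE ffunE vA.
    move: vAW; rewrite (negbTE vA) => /negbTE vW.
    by case/andP: colW => /forallP/(_ v); rewrite vW ffunE (negbTE vA).
  apply/implyP => mc'; rewrite -class_f //.
  by case/andP: colW => _ /forallP/(_ c'); rewrite ltnW.
case/andP=> /forallP k1 /forallP k2.
have k_gt v : v \in W :\: A -> (m < kappa v)%N by move=> vW; have := k1 v; rewrite vW.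
have k_0 v : v \notin W :\: A -> kappa v = c0.
  by move=> vW; have := k1 v; rewrite (negbTE vW) => /eqP.
have AE : color_class W (f kappa) c = A.
  apply/setP => v; rewrite inE ffunE; have [vA|vA] := ifPn.
    by rewrite eqxx (subsetP AW).
  apply/negP => /andP[vW /eqP kv]; have := k_gt v; rewrite inE vA vW kv /= => /(_ isT).
  by rewrite ltnn.
rewrite AE eqxx andbT; apply/andP; split; last first.
  apply/eqP/ffunP => v; rewrite !ffunE; case vA: (v \in A) => //.
  by rewrite k_0 // inE vA.
rewrite /colors_from; apply/andP; split; [apply/forallP => v | apply/forallP => c'].
  rewrite ffunE; case: ifP => vW; have [vA|vA] := ifPn.
  - by [].
  - by apply/ltnW/k_gt; rewrite inE vA.
  - by rewrite (subsetP AW) in vW.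
  - by rewrite k_0 // inE vW andbF.
apply/implyP; rewrite leq_eqVlt => /orP[/eqP mc'|mc'].
  have -> : c' = c by apply/val_inj.
  by rewrite AE cA sA.
by rewrite class_f //; apply: (implyP (k2 c')).
Qed.

End Colorings.

(** A coloring is proper exactly when its color classes are chains, and the exponent of its monomial
    lists the class sizes. *)
Lemma mcoeff_chromatic_qsym N (m : 'X_{1..N}) : (0 < n)%N ->
  (chromatic_qsym (incomparability prec) N)@_m = chain_count setT (multinom_val m).
Proof.
move=> n_gt0; rewrite /chromatic_qsym raddf_sum /=.
case: N m => [|N] m.
  rewrite big1 => [|kappa _]; last by case: (kappa (Ordinal n_gt0)).
  case: m => -[t]; rewrite /=; case: t => //= _.
  by rewrite -cards_eq0 cardsT card_ord -leqn0 leqNgt n_gt0.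
rewrite -[X in chain_count _ X]drop0 -(@sum_colors_from N.+1 ord0) //; last by rewrite size_tuple.
have E (kappa : {ffun 'I_n -> 'I_N.+1}) :
  colors_from ord0 (multinom_val m) 0 setT kappa =
  proper_coloring (incomparability prec) kappa && ((\sum_(v < n) U_(kappa v))%MM == m).
  apply/idP/idP.
    case/andP=> _ /forallP k2; apply/andP; split.
      apply/forallP => x; apply/forallP => y; apply/implyP => /and3P[xy pxy pyx].
      apply/negP => /eqP kxy; have /andP[/chainP ch _] := implyP (k2 (kappa x)) isT.
      case: (ltngtP x y) xy => [lt_xy|lt_yx|/val_inj->]; last by rewrite eqxx.
        by have := ch x y; rewrite !inE kxy eqxx (negbTE pxy) => /(_ isT isT lt_xy).
      by have := ch y x; rewrite !inE kxy eqxx (negbTE pyx) => /(_ isT isT lt_yx).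
    apply/eqP/mnmP => c; rewrite mnm_sumE (mnm_nth 0).
    have /andP[_ /eqP <-] := implyP (k2 c) isT.
    by rewrite -sum1_card [RHS]big_mkcond; apply: eq_bigr => v _; rewrite !inE mnmE; case: eqP.
  case/andP=> /forallP prop /eqP kE; rewrite /colors_from.
  apply/andP; split; [apply/forallP => v | apply/forallP => c]; first by rewrite inE.
  apply/implyP => _; apply/andP; split.
    apply/chainP => x y; rewrite !inE => /eqP kx /eqP ky xy.
    have := implyP (forallP (prop x) y); rewrite kx ky eqxx /incomparability => h.
    apply/negPn/negP => pxy; suff : false by []; apply: h.
    rewrite pxy neq_ltn xy /=; apply/negP => /prec_lt yx.
    by have := ltn_trans xy yx; rewrite ltnn.
  rewrite -(mnm_nth 0) -kE mnm_sumE -sum1_card big_mkcond; apply/eqP.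
  by apply: eq_bigr => v _; rewrite !inE mnmE; case: eqP.
rewrite (eq_bigl _ _ E) big_mkcondr; apply: eq_bigr => kappa _.
rewrite mcoeffZ mprodXE mcoeffX; case: eqP => _; last by rewrite mulr0.
rewrite mulr1; congr 'X^_; rewrite /asc /color_ascents -sum1_card.
rewrite pair_big /= big_mkcond [RHS]big_mkcond; apply: eq_bigr => -[x y] _.
rewrite !inE /incomparability /inc_ascent /=.
have [xy|] := ltnP x y; rewrite ?andbF //= neq_ltn xy /=.
have -> : ~~ prec y x by apply/negP => /prec_lt yx; have := ltn_trans xy yx; rewrite ltnn.
by case: (prec x y) => //=; case: ltnP.
Qed.

End ChainCounts.

(** * Partitions up to order and zero parts; duality of elementary symmetric polynomials *)

Lemma sumn_to_partition s : sumn (to_partition s) = sumn s.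
Proof.
have E : perm_eq (to_partition s) [seq k <- s | (0 < k)%N].
  by rewrite /to_partition; apply/seq.permPl/perm_sort.
by rewrite (perm_sumn E); elim: s {E} => //= k s IH; case: k => //= k; rewrite IH.
Qed.

Lemma to_partitionP s : is_partition (sumn s) (to_partition s).
Proof.
rewrite /is_partition sumn_to_partition eqxx andbT; apply/andP; split.
  by apply: sort_sorted => x y; apply: leq_total.
by rewrite /to_partition mem_sort mem_filter ltnn.
Qed.

Lemma to_partition_perm s t : perm_eq s t -> to_partition s = to_partition t.
Proof.
move=> st; apply/perm_sortP.
- by move=> x y; apply: leq_total.
- by move=> y x z /[swap]; apply: leq_trans.
- by move=> x y; rewrite andbC => /anti_leq.
exact: perm_filter.
Qed.

(** Equal lengths force equal numbers of zeros once the positive parts agree. *)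
Lemma eq_to_partition s t : size s = size t ->
  (to_partition s == to_partition t) = perm_eq s t.
Proof.
move=> sz; apply/eqP/idP => [eq_st|]; last exact: to_partition_perm.
have pos u : perm_eq (to_partition u) [seq k <- u | (0 < k)%N].
  by rewrite /to_partition; apply/seq.permPl/perm_sort.
have zeros u : [seq k <- u | predC (leq 1) k] = nseq (size u - size (to_partition u)) 0%N.
  rewrite (perm_size (pos u)) !size_filter -(count_predC (leq 1) u) addKn -size_filter.
  by apply/all_pred1P/allP => k; rewrite mem_filter /= -eqn0Ngt => /andP[].
rewrite -(perm_filterC (leq 1) s) perm_sym -(perm_filterC (leq 1) t) !zeros sz eq_st.
by rewrite perm_cat2r; apply: perm_trans (pos s); rewrite perm_sym eq_st.
Qed.

Lemma elem_sym_to_partition s N : elem_sym (to_partition s) N = elem_sym s N.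
Proof.
have E : perm_eq (to_partition s) [seq k <- s | (0 < k)%N].
  by rewrite /to_partition; apply/seq.permPl/perm_sort.
rewrite /elem_sym (perm_big _ E) big_filter big_mkcond /=.
by apply: eq_bigr => -[|k] _ //=; rewrite mesym0E.
Qed.

Lemma dhomog_elem_sym s N : elem_sym s N \is (sumn s).-homog.
Proof.
rewrite /elem_sym; elim: s => [|k s IH]; first by rewrite big_nil dhomog1.
by rewrite big_cons; apply: dhomogM IH; apply: dhomog_mesym.
Qed.

(* Both sides count the 0-1 matrices with row sums m and column sums u. *)
Lemma mesym_dual (R : nzRingType) (N k : nat) (m : 'X_{1..N}) (u : 'X_{1..k}) :
  (\prod_(i < N) mesym k R (m i))@_u = (\prod_(j < k) mesym N R (u j))@_m.
Proof.
have E a b (x : 'X_{1..a}) (y : 'X_{1..b}) : (\prod_(i < a) mesym b R (x i))@_y =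
    \sum_(H : {ffun 'I_a -> {set 'I_b}})
      ([forall i, #|H i| == x i] && [forall j, #|[set i | j \in H i]| == y j])%:R.
  under eq_bigr do rewrite mesymE.
  rewrite bigA_distr_big_dep raddf_sum /= big_mkcond; apply: eq_bigr => H _.
  rewrite mprodXE mcoeffX; have -> : (H \in family (fun i => [pred h : {set 'I_b} | #|h| == x i])) = [forall i, #|H i| == x i].
    by apply/familyP/forallP.
  case: ifP => //= _; congr (_%:R); congr (nat_of_bool _).
  apply/eqP/forallP => [<- j|yE]; last apply/mnmP => j.
    rewrite mnm_sumE -sum1_card big_mkcond; apply/eqP/eq_bigr => i _.
    by rewrite inE mnmE; case: (j \in H i).
  rewrite -(eqP (yE j)) mnm_sumE -sum1_card [RHS]big_mkcond; apply: eq_bigr => i _.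
  by rewrite inE mnmE; case: (j \in H i).
rewrite !E.
pose tr a b (H : {ffun 'I_a -> {set 'I_b}}) := [ffun j => [set i | j \in H i]].
have trK a b : cancel (@tr a b) (@tr b a).
  by move=> H; apply/ffunP => i; rewrite ffunE; apply/setP => j; rewrite inE ffunE inE.
rewrite (reindex (@tr k N)) /=; last by exists (@tr N k) => H _; apply: trK.
apply: eq_bigr => H _; rewrite andbC; congr (_%:R); congr (nat_of_bool (_ && _)).
  apply: eq_forallb => j; congr (_ == _); apply: eq_card => i; rewrite !inE ffunE inE //.
by apply: eq_forallb => i; rewrite ffunE.
Qed.

(** * Monomial symmetric polynomials in three variables *)

(** The monomial symmetric polynomial m_lam, zero when [lam] has more than three parts; the degree
    bound only makes the index type finite. *)
Definition mono3 (lam : seq nat) : {mpoly {poly int}[3]} :=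
  \sum_(u : 'X_{1..3 < (sumn lam).+1} | to_partition (multinom_val u) == lam) 'X_[u].

Lemma mcoeff_mono3 lam (u : 'X_{1..3}) :
  (mono3 lam)@_u = (to_partition (multinom_val u) == lam)%:R.
Proof.
rewrite /mono3 raddf_sum /=; case: eqP => [uE|uE].
  have ltu : (mdeg u < (sumn lam).+1)%N.
    by rewrite -uE sumn_to_partition mdegE sumnE big_tuple.
  rewrite (bigD1 (BMultinom ltu)) /= ?uE // mcoeffX eqxx big1 ?addr0 // => v /andP[_ ne].
  by rewrite mcoeffX; case: eqP => // vu; case/eqP: ne; apply: val_inj.
rewrite big1 // => v /eqP vE; rewrite mcoeffX; case: eqP => // vu.
by rewrite -vE vu in uE.
Qed.

Lemma mono3_sym lam : mono3 lam \is symmetric.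
Proof.
apply/issymP => s; apply/mpolyP => u; rewrite mcoeff_sym !mcoeff_mono3.
congr (_ == _)%:R; apply: to_partition_perm.
by apply/tuple_permP; exists s; congr val; apply: eq_mktuple => i; rewrite multinomE.
Qed.

(** m_lam rewritten in the variables e_1, e_2, e_3, on which [chain_eval] is defined. *)
Definition mono3_gen lam : {mpoly {poly int}[3]} := symf (mono3 lam).

Local Notation in_e f := (f \mPo [tuple mesym 3 {poly int} i.+1 | i < 3]).

Lemma in_eM f g : in_e (f * g) = in_e f * in_e g.
Proof. by rewrite rmorphM. Qed.

Lemma in_eX f k : in_e (f ^+ k) = in_e f ^+ k.
Proof. by rewrite rmorphXn. Qed.

Lemma in_e_gen a : in_e (gen a) = mesym 3 {poly int} a.
Proof.
case: a => [|a]; first by rewrite /gen comp_mpoly1 mesym0E.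
rewrite /gen; case: insubP => [i _ <-|]; last by rewrite -leqNgt => a3; rewrite raddf0 mesym_geqnE.
by rewrite /= comp_mpolyXU -tnth_nth tnth_mktuple.
Qed.

(** The coefficient of x^m in the dual Cauchy identity. Comparing coefficients of t^u reduces it to
    [mesym_dual]: only the partition obtained by sorting [u] contributes, and none does unless [u]
    has degree [n]. *)
Lemma prod_gen_mono3 n N (m : 'X_{1..N}) : mdeg m = n ->
  \prod_(i < N) gen (m i) =
  \sum_(lam : n.-bseq 'I_n.+1 | is_partition n (map val lam))
     (elem_sym (map val lam) N)@_m *: mono3_gen (map val lam).
Proof.
move=> mn; apply: msym_fundamental_un.
rewrite rmorph_prod raddf_sum /=.
under eq_bigr do rewrite in_e_gen.
under [RHS]eq_bigr do rewrite comp_mpolyZ -symfP ?mono3_sym //.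
apply/mpolyP => u; rewrite mesym_dual raddf_sum /=.
have -> : \prod_(j < 3) mesym N {poly int} (u j) = elem_sym (multinom_val u) N.
  by rewrite /elem_sym big_tuple.
under [RHS]eq_bigr do rewrite mcoeffZ mcoeff_mono3.
have uP := to_partitionP (multinom_val u).
have mdu : sumn (multinom_val u) = mdeg u by rewrite mdegE sumnE big_tuple.
have [un|un] := eqVneq (mdeg u) n.
  rewrite mdu un in uP; have [lam lamE] := partition_bseq uP.
  rewrite (bigD1 lam) /= ?lamE // eqxx mulr1 elem_sym_to_partition big1 ?addr0 // => mu /andP[_ ne].
  case: eqP => [e|_]; last by rewrite mulr0.
  by case/eqP: ne; apply: val_inj; apply: (inj_map val_inj); rewrite /= -e lamE.
have -> : (elem_sym (multinom_val u) N)@_m = 0.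
  apply: dhomog_nemf_coeff (dhomog_elem_sym _ _) _.
  by suff : mdeg m != sumn (multinom_val u) by []; rewrite mdu mn eq_sym.
rewrite big1 // => lam lamP.
case: eqP => [e|_]; last by rewrite mulr0.
by case/and3P: lamP => _ _ /eqP; rewrite -e sumn_to_partition mdu => /eqP; rewrite (negbTE un).
Qed.

(** * Explicit expressions in e_1, e_2, e_3 *)

Local Notation i0 := (@Ordinal 3 0 isT).
Local Notation i1 := (@Ordinal 3 1 isT).
Local Notation i2 := (@Ordinal 3 2 isT).

Lemma big_ord3 (T : Type) (idx : T) (op : Monoid.law idx) (F : 'I_3 -> T) :
  \big[op/idx]_(i < 3) F i = op (F i0) (op (F i1) (F i2)).
Proof.
rewrite !big_ord_recl big_ord0 Monoid.mulm1.
by do !congr (op _ _); congr F; apply: val_inj.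
Qed.

Definition mnm3 a b c : 'X_{1..3} := [multinom [tuple a; b; c]].

Lemma mnm3E (u : 'X_{1..3}) : u = mnm3 (u i0) (u i1) (u i2).
Proof.
apply/mnmP => i; rewrite multinomE (tnth_nth 0%N).
by case: i => -[|[|[|//]]] lt_i /=; congr (u _); apply: val_inj.
Qed.

Lemma mcoeff_mnm3 (R : nzRingType) a b c a' b' c' :
  ('X_[mnm3 a b c] : {mpoly R[3]})@_(mnm3 a' b' c') =
  [&& a == a', b == b' & c == c']%:R.
Proof.
rewrite mcoeffX; congr (nat_of_bool _)%:R; apply/eqP/and3P => [e|[/eqP-> /eqP-> /eqP->]] //.
by have /val_eqP/eqP[-> -> ->] := e.
Qed.

Lemma mpolyX_mnm3 (R : nzRingType) a b c :
  'X_[mnm3 a b c] = 'X_i0 ^+ a * ('X_i1 ^+ b * 'X_i2 ^+ c) :> {mpoly R[3]}.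
Proof. by rewrite mpolyXE_id big_ord3 /mnm3 !multinomE !(tnth_nth 0%N). Qed.

Lemma mcoeff_mesym3 (R : nzRingType) k a b c : (mesym 3 R k)@_(mnm3 a b c) =
  [&& a + b + c == k, a <= 1, b <= 1 & c <= 1]%N%:R.
Proof.
rewrite mcoeff_mesym /mechar mdegE big_ord3 /=.
have -> : [forall i, mnm3 a b c i <= 1]%N = \big[andb/true]_(i < 3) (mnm3 a b c i <= 1)%N.
  by rewrite big_andE.
by rewrite big_ord3 /mnm3 !multinomE !(tnth_nth 0%N) /= addnA.
Qed.

Lemma mesym32 (R : comNzRingType) :
  mesym 3 R 2 = 'X_i0 * 'X_i1 + 'X_i0 * 'X_i2 + 'X_i1 * 'X_i2.
Proof.
transitivity ('X_[mnm3 1 1 0] + 'X_[mnm3 1 0 1] + 'X_[mnm3 0 1 1] : {mpoly R[3]}).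
  apply/mpolyP => u; rewrite [u]mnm3E !mcoeffD !mcoeff_mnm3 mcoeff_mesym3.
  case: (u i0) (u i1) (u i2) => [|[|a]] [|[|b]] [|[|c]] //=; by rewrite ?addr0 ?add0r ?ltnS ?ltn0 ?andbF.
by rewrite !mpolyX_mnm3; ring.
Qed.

Lemma in_e_power_sum k :
  in_e (power_sum k) = 'X_i0 ^+ k + 'X_i1 ^+ k + 'X_i2 ^+ k.
Proof.
have e1E : mesym 3 {poly int} 1 = 'X_i0 + 'X_i1 + 'X_i2 by rewrite mesym1E big_ord3 /= addrA.
have e3E : mesym 3 {poly int} 3 = 'X_i0 * 'X_i1 * 'X_i2 by rewrite mesymnnE big_ord3 /= mulrA.
have e2E := mesym32 {poly int}.
have in_nat j : in_e (j%:R) = j%:R by rewrite rmorph_nat.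
have [m] := ubnP k; elim: m k => // m IH [|[|[|k]]] ltkm.
- by rewrite !expr0 -[power_sum 0]/3%:R in_nat; ring.
- by rewrite -[power_sum 1]/(gen 1) in_e_gen e1E !expr1.
- rewrite -[power_sum 2]/(gen 1 * gen 1 - 2 * gen 2) comp_mpolyB !in_eM in_nat !in_e_gen e1E e2E.
  by ring.
rewrite -[power_sum _]/(gen 1 * power_sum k.+2 - gen 2 * power_sum k.+1 + gen 3 * power_sum k).
have lt2 : (k.+2 < m)%N by []; have lt1 := ltnW lt2; have lt0 := ltnW lt1.
rewrite comp_mpolyD comp_mpolyB !in_eM !in_e_gen (IH _ lt2) (IH _ lt1) (IH _ lt0) e1E e2E e3E.
by rewrite !exprS; ring.
Qed.
Lemma perm_eq2 (T : eqType) (B C b c : T) : perm_eq [:: b; c] [:: B; C] ->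
  [&& B == b & C == c] || [&& C == b & B == c].
Proof.
move=> h; have : b \in [:: B; C] by rewrite -(perm_mem h) mem_head.
rewrite !inE => /orP[] /eqP e; rewrite {b}e in h *.
  rewrite perm_cons in h; have : c \in [:: C] by rewrite -(perm_mem h) mem_head.
  by rewrite inE eq_sym eqxx => ->.
have {h} h : perm_eq [:: c] [:: B].
  by rewrite -(perm_cons C) (perm_trans h) //; apply/seq.permP => p /=; lia.
have : c \in [:: B] by rewrite -(perm_mem h) mem_head.
by rewrite inE eq_sym eqxx => ->; rewrite orbT.
Qed.

Lemma perm_eq3 (A B C a b c : nat) : perm_eq [:: a; b; c] [:: A; B; C] =
  [|| [&& A == a, B == b & C == c], [&& A == a, C == b & B == c],
      [&& B == a, A == b & C == c], [&& B == a, C == b & A == c],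
      [&& C == a, A == b & B == c] | [&& C == a, B == b & A == c]].
Proof.
apply/idP/idP => [h|]; last first.
  by case/or4P => [|||/or3P[]] /and3P[/eqP<- /eqP<- /eqP<-]; apply/seq.permP => p /=; lia.
have : a \in [:: A; B; C] by rewrite -(perm_mem h) mem_head.
rewrite !inE => /or3P[] /eqP e; rewrite {a}e in h *; rewrite eqxx.
- rewrite perm_cons in h.
  by case/orP: (perm_eq2 h) => ->; rewrite ?orbT.
- have /perm_eq2/orP[|] : perm_eq [:: b; c] [:: A; C].
    by rewrite -(perm_cons B) (perm_trans h) //; apply/seq.permP => p /=; lia.
  + by move=> ->; rewrite !orbT.
  + by move=> ->; rewrite !orbT.
have /perm_eq2/orP[|] : perm_eq [:: b; c] [:: A; B].
  by rewrite -(perm_cons C) (perm_trans h) //; apply/seq.permP => p /=; lia.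
+ by move=> ->; rewrite !orbT.
+ by move=> ->; rewrite !orbT.
Qed.

Lemma mcoeff_mono3_mnm3 A B C a b c :
  (mono3 (to_partition [:: A; B; C]))@_(mnm3 a b c) = (perm_eq [:: a; b; c] [:: A; B; C])%:R.
Proof. by rewrite mcoeff_mono3 eq_to_partition. Qed.

Lemma mono3_lt A B C : (C < B < A)%N -> mono3 (to_partition [:: A; B; C]) =
  'X_[mnm3 A B C] + 'X_[mnm3 A C B] + 'X_[mnm3 B A C] +
  'X_[mnm3 B C A] + 'X_[mnm3 C A B] + 'X_[mnm3 C B A].
Proof.
case/andP=> CB BA; apply/mpolyP => u; rewrite [u]mnm3E; move: (u i0) (u i1) (u i2) => a b c.
rewrite mcoeff_mono3_mnm3 !mcoeffD !mcoeff_mnm3 perm_eq3 -!natrD; congr _%:R.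
(* As the parts are distinct, no number matches two of them; at most one of the six arrangements
   holds, and their disjunction equals their sum. *)
have AB x : ~~ ((A == x) && (B == x)) by apply/negP => /andP[/eqP eA /eqP eB]; rewrite eA eB ltnn in BA.
have BC x : ~~ ((B == x) && (C == x)) by apply/negP => /andP[/eqP eA /eqP eB]; rewrite eA eB ltnn in CB.
have AC x : ~~ ((A == x) && (C == x)).
  by apply/negP => /andP[/eqP eA /eqP eC]; have := ltn_trans CB BA; rewrite eA eC ltnn.
move: (AB a) (AB b) (AB c) (BC a) (BC b) (BC c) (AC a) (AC b) (AC c).
by case: (A == a); case: (B == a); case: (C == a) => //=; case: (A == b); case: (B == b);
  case: (C == b) => //=; case: (A == c); case: (B == c); case: (C == c).
Qed.

Lemma mono3_eq A C : A != C -> mono3 (to_partition [:: A; A; C]) =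
  'X_[mnm3 A A C] + 'X_[mnm3 A C A] + 'X_[mnm3 C A A].
Proof.
move=> neAC; apply/mpolyP => u; rewrite [u]mnm3E; move: (u i0) (u i1) (u i2) => a b c.
rewrite mcoeff_mono3_mnm3 !mcoeffD !mcoeff_mnm3 perm_eq3 -!natrD; congr _%:R.
have AC x : ~~ ((A == x) && (C == x)).
  by apply/negP => /andP[/eqP eA /eqP eC]; rewrite eA eC eqxx in neAC.
move: (AC a) (AC b) (AC c).
by case: (A == a); case: (C == a) => //=; case: (A == b); case: (C == b) => //=;
  case: (A == c); case: (C == c).
Qed.

Lemma mono3_genE lam f : in_e f = mono3 lam -> mono3_gen lam = f.
Proof. by move=> fE; apply: msym_fundamental_un; rewrite fE -symfP // mono3_sym. Qed.

(** The factor e_3^l = (t_1 t_2 t_3)^l lowers all exponents by l and leaves m_(k,1). For [k = 1] the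
    product p_1 p_k would give 2 e_2, whence the separate lemmas below, where the division leaves
    e_1 and e_2. *)
Lemma mono3_gen_lt k l : (1 < k)%N ->
  mono3_gen (to_partition [:: (k + l)%N; l.+1; l]) =
  gen 3 ^+ l * (gen 1 * power_sum k - power_sum k.+1).
Proof.
move=> k1; apply: mono3_genE; rewrite mono3_lt; last by lia.
rewrite in_eM in_eX comp_mpolyB in_eM !in_e_power_sum !in_e_gen.
rewrite mesym1E mesymnnE !big_ord3 /= !mpolyX_mnm3 !exprMn addnC !exprD !exprS.
by ring.
Qed.

Lemma mono3_gen_eqS l : mono3_gen (to_partition [:: l; l.+1; l]) = gen 3 ^+ l * gen 1.
Proof.
apply: mono3_genE; have -> : to_partition [:: l; l.+1; l] = to_partition [:: l; l; l.+1].
  by apply: to_partition_perm; apply/seq.permP => p /=; lia.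
rewrite mono3_eq; last by rewrite neq_ltn ltnSn.
rewrite in_eM in_eX !in_e_gen.
rewrite mesym1E mesymnnE !big_ord3 /= !mpolyX_mnm3 !exprMn !exprS.
by ring.
Qed.

Lemma mono3_gen_Seq l : mono3_gen (to_partition [:: l.+1; l.+1; l]) = gen 3 ^+ l * gen 2.
Proof.
apply: mono3_genE; rewrite mono3_eq; last by rewrite neq_ltn ltnSn orbT.
rewrite in_eM in_eX !in_e_gen.
rewrite mesym32 mesymnnE !big_ord3 /= !mpolyX_mnm3 !exprMn !exprS.
by ring.
Qed.

(** * The coefficients of the e-expansion *)

Section Expansion.

Variables (n : nat) (prec : rel 'I_n) (level : 'I_n -> nat).
Hypothesis prec_lt : forall x y, prec x y -> (x < y)%N.
Hypothesis prec_mono : forall x x' y y' : 'I_n,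
  (x <= x')%N -> prec x' y' -> (y' <= y)%N -> prec x y.
Hypothesis level_lt : forall x, (level x < 3)%N.
Hypothesis level_prec : forall x y, prec x y -> (level x < level y)%N.

Definition e_coef (lam : seq nat) : {poly int} := chain_eval prec setT (mono3_gen lam).

Lemma chain_eval_prod_gen (W : {set 'I_n}) (s : seq nat) :
  chain_eval prec W (\prod_(a <- s) gen a) = chain_count prec W s.
Proof.
elim: s W => [|a s IH] W; first by rewrite big_nil chain_eval1.
rewrite big_cons (chain_eval_gen prec_lt prec_mono level_lt level_prec).
rewrite -(peel_descend prec_lt prec_mono) //= /peel.
have -> : [set x in W | xpredT x] = W by apply/setP => x; rewrite !inE andbT.
by apply: eq_bigr => A _; rewrite IH.
Qed.

Lemma e_expansion_chromatic_qsym : (0 < n)%N ->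
  e_expansion n (chromatic_qsym (incomparability prec)) e_coef.
Proof.
move=> n_gt0 N; apply/mpolyP => m; rewrite (mcoeff_chromatic_qsym prec_lt) // raddf_sum /=.
under [RHS]eq_bigr do rewrite mcoeffZ.
have sum_m : sumn (multinom_val m) = mdeg m by rewrite mdegE sumnE big_tuple.
have [mn|mn] := eqVneq (mdeg m) n.
  rewrite -chain_eval_prod_gen big_tuple.
  rewrite (prod_gen_mono3 mn) chain_eval_sum; apply: eq_bigr => lam _.
  by rewrite chain_evalZ mulrC.
rewrite chain_count_size ?sum_m ?cardsT ?card_ord // big1 // => lam /and3P[_ _ /eqP lamn].
rewrite (dhomog_nemf_coeff (dhomog_elem_sym _ _)) ?mulr0 //.
by suff : mdeg m != sumn (map val lam) by []; rewrite lamn.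
Qed.

(** With k = n - 3l the first part is l + k - 1. For k >= 3 it is the largest and [mono3_gen_lt]
    applies; k = 1 and k = 2 give e_3^l e_1 and e_3^l e_2. For k = 0 it drops to l - 1, and sorting
    gives (l+1, l, l-1), the shape of [mono3_gen_lt] with 2 and l - 1. *)
Lemma e_coef_nat l : (2 < n)%N -> (3 * l <= n)%N ->
  e_coef (to_partition [:: (n - 2 * l - 1)%N; l.+1; l]) \is a polyOver Num.nat.
Proof.
move=> n3 ln; rewrite /e_coef.
have mono_nat k j : (1 < k)%N -> n = (k + 3 * j).+1 ->
    chain_eval prec setT (mono3_gen (to_partition [:: (k + j)%N; j.+1; j])) \is a polyOver Num.nat.
  move=> k1 nE; rewrite mono3_gen_lt //.
  apply: (chain_eval_gen3_nat prec_lt prec_mono level_lt level_prec) => W'.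
  rewrite cardsT card_ord [RHS]nE -addSn => /addIn cW'.
  exact: (chain_eval_mono_nat prec_lt prec_mono level_lt level_prec).
have gen_nat a : chain_eval prec setT (gen 3 ^+ l * gen a) \is a polyOver Num.nat.
  apply: (chain_eval_gen3_nat prec_lt prec_mono level_lt level_prec) => W' _.
  exact: (chain_eval_gen_nat prec_lt prec_mono level_lt level_prec).
have [k nE] : exists k, n = (k + 3 * l)%N by exists (n - 3 * l)%N; rewrite subnK.
case: k nE => [|[|[|k]]] nE.
- case: l nE {ln gen_nat} => [|l] nE; first by exfalso; lia.
  have -> : to_partition [:: (n - 2 * l.+1 - 1)%N; l.+2; l.+1] =
      to_partition [:: (2 + l)%N; l.+1; l].
    have -> : (n - 2 * l.+1 - 1)%N = l by lia.
    by apply: to_partition_perm; apply/seq.permP => p /=; rewrite add2n; lia.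
  have e : n = (2 + 3 * l).+1 by clear -nE; lia.
  exact: (mono_nat 2%N l isT e).
- have -> : (n - 2 * l - 1)%N = l by clear -nE; lia.
  by rewrite mono3_gen_eqS; apply: gen_nat.
- have -> : (n - 2 * l - 1)%N = l.+1 by clear -nE; lia.
  by rewrite mono3_gen_Seq; apply: gen_nat.
have -> : (n - 2 * l - 1)%N = (k.+2 + l)%N by clear -nE; lia.
have e : n = (k.+2 + 3 * l).+1 by clear -nE; lia.
exact: (mono_nat k.+2 l isT e).
Qed.

End Expansion.

(** * Dyck paths of bounce number three *)

Section DyckPath.

Variables (n : nat) (d : seq nat).
Hypothesis hd : dyck_path n d.

(** The minimum covers the indices from [n] on, where [dyck_at] takes its default value [n]. *)
Lemma dyck_at_ge i : (0 < i)%N -> (minn i n <= dyck_at n d i)%N.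
Proof.
case: hd => n0 sz _ _ ge_i i0; have [lt_in|le_ni] := ltnP i n.
  by rewrite ge_i // i0.
by rewrite /dyck_at nth_default // sz; case: (i) le_ni i0 n0 => // j; case: (n).
Qed.

Lemma dyck_at_le i : (0 < i)%N -> (dyck_at n d i <= n)%N.
Proof.
case: hd => n0 sz _ le_n _ i0; have [lt_in|le_ni] := ltnP i n.
  by have := le_n i; rewrite i0 lt_in => /(_ isT)/andP[].
by rewrite /dyck_at nth_default // sz; case: (i) le_ni i0 n0 => // j; case: (n).
Qed.

Lemma dyck_at_mono i j : (0 < i)%N -> (i <= j)%N -> (dyck_at n d i <= dyck_at n d j)%N.
Proof.
case: (hd) => n0 sz sorted_d _ _ i0 le_ij; have [lt_jn|le_nj] := ltnP j n.
  apply: (sorted_leq_nth leq_trans leqnn) => //; rewrite ?inE ?sz; lia.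
apply: leq_trans (dyck_at_le i0) _.
by have := dyck_at_ge (leq_trans i0 le_ij); rewrite (minn_idPr le_nj).
Qed.

Lemma dyck_prec_lt (x y : 'I_n) : dyck_prec d x y -> (x < y)%N.
Proof.
case/andP=> xn /andP[dxy _]; rewrite -ltnS; apply: leq_ltn_trans dxy.
by have := @dyck_at_ge x.+1 isT; rewrite (minn_idPl (ltnW xn)).
Qed.

Lemma dyck_prec_mono (x x' y y' : 'I_n) :
  (x <= x')%N -> dyck_prec d x' y' -> (y' <= y)%N -> dyck_prec d x y.
Proof.
move=> xx' /andP[x'n /andP[dxy _]] yy'; apply/and3P; split=> //.
  exact: leq_ltn_trans x'n.
by apply: leq_ltn_trans (dyck_at_mono _ _) (leq_trans dxy _).
Qed.

Hypothesis hbounce : bounce_number n d = 3%N.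

Local Notation m0 := (dyck_at n d 1).
Local Notation m1 := (dyck_at n d m0.+1).

Lemma bounce_n_ge3 : (2 < n)%N.
Proof.
move: hbounce; rewrite /bounce_number /bounce_seq size_take size_traject.
by case: ltnP => [lt_i e|_ ->] //; rewrite e in lt_i; apply: ltnW.
Qed.

Lemma bounce_seq_last :
  bounce_seq n d = [:: m0; m1; dyck_at n d m1.+1] /\ dyck_at n d m1.+1 = n.
Proof.
have traject3 (f : nat -> nat) x k : (2 < k)%N -> traject f x k =
    [:: x, f x, f (f x) & traject f (f (f (f x))) (k - 3)].
  by case: k => [|[|[|k]]] // _; rewrite !subSS subn0.
(* For [n = 3] the length 3 may come from the cut of the trajectory at [n] terms; that the third
   term is [n] then follows from d_i >= i. *)
have last_ge : n = 3%N -> dyck_at n d m1.+1 = n.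
  move=> n3; apply/eqP; rewrite eqn_leq dyck_at_le //=.
  have := @dyck_at_ge m1.+1 isT; have := @dyck_at_ge m0.+1 isT; have := @dyck_at_ge 1 isT.
  lia.
have n3 := bounce_n_ge3; move: hbounce; rewrite /bounce_number /bounce_seq.
set t := traject _ _ n; have tE : t = _ := traject3 _ _ _ n3.
rewrite size_take size_traject; case: ltnP => [lt_i [e]|le_n nE].
  have n_t : n \in t by rewrite -index_mem size_traject ltnW.
  by have := nth_index 0%N n_t; rewrite e tE /= take0.
rewrite take_oversize ?size_traject // tE; split; last exact: last_ge.
by rewrite nE.
Qed.

(** The ordinal [x] stands for x + 1, so [m0 <= x] means being beyond S_1: the levels 0, 1, 2 are
    the blocks S_1, S_2, S_3. *)
Definition bounce_level (x : 'I_n) : nat := ((m0 <= x) + (m1 <= x))%N.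

Lemma bounce_level_lt x : (bounce_level x < 3)%N.
Proof. by rewrite /bounce_level; case: (m0 <= x)%N; case: (m1 <= x)%N. Qed.

Lemma m0_le_m1 : (m0 <= m1)%N.
Proof.
apply: leq_trans (dyck_at_ge _) => //; rewrite leq_min leqnSn.
exact: dyck_at_le.
Qed.

(** Every [y] above some element is beyond d_1 = m_0; if [x] is beyond S_1, then [y] is beyond d at
    m_0 + 1, which is m_1; and nothing is above an element of S_3, as d at m_1 + 1 is [n]. *)
Lemma bounce_level_prec (x y : 'I_n) :
  dyck_prec d x y -> (bounce_level x < bounce_level y)%N.
Proof.
move=> pxy; have lt_xy := dyck_prec_lt pxy.
case/andP: pxy => _ /andP[dxy _]; rewrite ltnS in dxy.
have m0y : (m0 <= y)%N by apply: leq_trans dxy; apply: dyck_at_mono.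
rewrite /bounce_level m0y; case: (leqP m0 x) => [m0x|_]; last first.
  by case: (leqP m1 x) => // m1x; rewrite (leq_trans m1x (ltnW lt_xy)).
have m1y : (m1 <= y)%N by apply: leq_trans dxy; apply: dyck_at_mono.
rewrite m1y; case: (leqP m1 x) => // m1x.
have : (dyck_at n d m1.+1 <= y)%N by apply: leq_trans dxy; apply: dyck_at_mono.
by rewrite bounce_seq_last.2 leqNgt ltn_ord.
Qed.

Lemma card_bounce_blocks :
  (#|bounce_block n d 1| + #|bounce_block n d 2| + #|bounce_block n d 3| <= n)%N.
Proof.
have cardE (A : {set 'I_n}) : #|A| = (\sum_(v < n) (v \in A))%N.
  by rewrite -sum1_card big_mkcond; apply: eq_bigr => v _; case: (v \in A).
rewrite !cardE -!big_split /= -[leqRHS]card_ord -sum1_card; apply: leq_sum => v _.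
rewrite !inE bounce_seq_last.1 /=; have := m0_le_m1.
by case: leqP; case: leqP; case: leqP => //=; lia.
Qed.

End DyckPath.

Theorem theorem3p6 (n : nat) (d : seq nat)
    (hd : dyck_path n d) (hbounce : bounce_number n d = 3%N) :
  exists2 coef : seq nat -> {poly int},
    e_expansion n (chromatic_qsym (incomparability (@dyck_prec n d))) coef &
    forall l : nat,
      (l <= minn #|bounce_block n d 3|
                 (minn #|bounce_block n d 2| #|bounce_block n d 1|))%N ->
      coef (to_partition [:: (n - 2 * l - 1)%N; l.+1; l]) \is a polyOver Num.nat.
Proof.
have n3 := bounce_n_ge3 hbounce.
exists (e_coef (@dyck_prec n d)).
  apply: (e_expansion_chromatic_qsym (dyck_prec_lt hd) (dyck_prec_mono hd)
    (@bounce_level_lt n d) (bounce_level_prec hd hbounce)).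
  exact: leq_trans n3.
move=> l; rewrite !leq_min => /and3P[l3 l2 l1].
apply: (e_coef_nat (dyck_prec_lt hd) (dyck_prec_mono hd)
    (@bounce_level_lt n d) (bounce_level_prec hd hbounce) n3).
(* The three blocks are disjoint and have at least [l] elements each, whence 3l <= n. *)
apply: leq_trans (card_bounce_blocks hd hbounce).
by rewrite 2!mulSn mul1n addnA !leq_add.
Qed.
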